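(* Let $K$ be a compact Hausdorff space that is a Gruenhage space. Then: (1) the dual space $\mathscr{C}(K)^*$ admits an equivalent, strictly convex, dual lattice norm; (2) $\mathscr{C}(K)^*$ admits an equivalent, dual p-UR norm.
   Context: All Banach spaces are real. A topological space $X$ is a Gruenhage space if there exist families $(\mathscr{U}_n)_{n\in\mathbb{N}}$ of open subsets of $X$ such that for any distinct $x,y\in X$ there exist $n\in\mathbb{N}$ and $U\in\mathscr{U}_n$ with: (i) $U\cap\{x,y\}$ is a singleton; (ii) either $x$ lies in only finitely many $U'\in\mathscr{U}_n$ or $y$ lies in only finitely many $U'\in\mathscr{U}_n$. $\mathscr{C}(K)$ is the Banach space of continuous real-valued functions on $K$ with the supremum norm; $\mathscr{C}(K)^*$ is identified with the space of regular signed Borel measures on $K$ with the total variation norm. A dual norm on $Z^*$ is one that is the dual norm of some equivalent norm on $Z$ (equivalently, an equivalent norm that is $w^*$-lower semicontinuous). A norm $\|\cdot\|$ is strictly convex if $\|x\|=\|y\|=\frac12\|x+y\|$ implies $x=y$. A lattice norm is one for which $|\mu|\le|\nu|$ implies $\|\mu\|\le\|\nu\|$. A norm $\|\cdot\|$ on a Banach space $Z$ is pointwise uniformly rotund (p-UR) if there is a subspace $F\subseteq Z^*$ separating points of $Z$ such that whenever $(x_n),(y_n)$ are sequences in $Z$ with $\|x_n\|=\|y_n\|=1$ and $\|x_n+y_n\|\to 2$, we have $f(x_n-y_n)\to 0$ for all $f\in F$. *)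

(* Defs.v *)
From HB Require Import structures.
From mathcomp Require Import all_boot all_order all_algebra.
From mathcomp Require Import all_classical all_reals all_analysis.

Set Implicit Arguments.
Unset Strict Implicit.
Unset Printing Implicit Defensive.

Import Order.TTheory GRing.Theory Num.Theory.
Import numFieldNormedType.Exports.

Local Open Scope classical_set_scope.
Local Open Scope ring_scope.

Definition gruenhage (X : topologicalType) : Prop :=
  exists U : nat -> set (set X),
    (forall n V, U n V -> open V) /\
    forall x y : X, x <> y ->
      exists n V, [/\ U n V,
        exists z, V `&` [set x; y] = [set z] &
        finite_set [set W | U n W /\ W x] \/
        finite_set [set W | U n W /\ W y]].

Section norms.
Context {R : realType}.

Definition is_norm (V : lmodType R) (N : V -> R) : Prop :=
  [/\ forall x y, N (x + y) <= N x + N y,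
      forall a x, N (a *: x) = `|a| * N x &
      forall x, N x = 0 -> x = 0].

Definition equivalent_norm (V : normedModType R) (N : V -> R) : Prop :=
  is_norm N /\
  exists c C : R,
    [/\ 0 < c, 0 < C & forall x, c * `|x| <= N x <= C * `|x|].

Definition strictly_convex (V : lmodType R) (N : V -> R) : Prop :=
  forall x y, N x = N y -> N y = 2^-1 * N (x + y) -> x = y.

(* [F] is a linear subspace of the continuous dual of [V]; continuity refers
   to the given norm of [V], hence to any equivalent one. *)
Definition dual_subspace (V : normedModType R) (F : set (V -> R^o)) : Prop :=
  [/\ forall f, F f -> linear f /\ continuous f,
      F 0 & forall (a : R) f g, F f -> F g -> F (a *: f + g)].

Definition pointwise_uniformly_rotund (V : normedModType R) (N : V -> R) :
    Prop :=
  exists F : set (V -> R^o),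
    [/\ dual_subspace F,
        forall x y, x <> y -> exists2 f, F f & f x <> f y &
        forall x y : nat -> V,
          (forall n, N (x n) = 1) -> (forall n, N (y n) = 1) ->
          N (x n + y n) @[n --> \oo] --> (2 : R) ->
          forall f, F f -> f (x n - y n) @[n --> \oo] --> (0 : R^o)].

End norms.

Section continuous_functions.
Context (R : realType) (K : topologicalType).

Definition cont_pred : {pred K -> R^o} := mem [set f : K -> R^o | continuous f].

(* The compactness proof is a parameter of the type because the supremum norm
   is finite for all continuous functions on compact spaces only. *)
Record cspace (cK : compact [set: K]) := CSpace {
  cspace_fun :> K -> R^o ;
  _ : cspace_fun \in cont_pred }.

Context (cK : compact [set: K]).
Local Notation CK := (cspace cK).

HB.instance Definition _ := [isSub for @cspace_fun cK].
HB.instance Definition _ := [Choice of CK by <:].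

Lemma cont_submod_closed : submod_closed cont_pred.
Proof.
split; first by rewrite inE /= => x; exact: cst_continuous.
move=> a f g; rewrite !inE /= => cf cg x.
by apply: cvgD; [apply: cvgZl_tmp; exact: cf|exact: cg].
Qed.

HB.instance Definition _ :=
  GRing.isSubmodClosed.Build _ _ cont_pred cont_submod_closed.
HB.instance Definition _ := [SubChoice_isSubLmodule of CK by <:].

Lemma cspace_continuous (f : CK) : continuous f.
Proof. by case: f => f fP; exact: (set_mem fP). Qed.

Definition sup_norm (f : CK) : R := sup [set `|f x| | x in [set: K]].

Lemma sup_norm_has_ubound (f : CK) : has_ubound [set `|f x| | x in [set: K]].
Proof.
have : compact ((fun x => `|f x|) @` [set: K]).
  apply: continuous_compact => //; apply: continuous_subspaceT => x.
  by apply: cvg_norm; exact: cspace_continuous.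
move=> /compact_bounded [M [_ Mb]]; exists (M + 1) => y Ky.
apply: (le_trans (ler_norm _)).
by apply: (Mb (M + 1)) => //; rewrite ltrDl.
Qed.

Lemma le_sup_norm (f : CK) x : `|f x| <= sup_norm f.
Proof. by apply: ub_le_sup; [exact: sup_norm_has_ubound|exists x]. Qed.

Lemma sup_norm_le (f : CK) (M : R) :
  0 <= M -> (forall x, `|f x| <= M) -> sup_norm f <= M.
Proof.
move=> M0 fM; have [/set0P ne|/negPn/eqP] := boolP
    ([set `|f x| | x in [set: K]] != set0).
  by apply: ge_sup => // _ [x _ <-].
by rewrite /sup_norm => ->; rewrite sup0.
Qed.

Lemma sup_norm_ge0 (f : CK) : 0 <= sup_norm f.
Proof.
have [/set0P[_ [x _ _]]|/negPn/eqP] := boolP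
    ([set `|f x| | x in [set: K]] != set0).
  exact: le_trans (le_sup_norm f x).
by rewrite /sup_norm => ->; rewrite sup0.
Qed.

Lemma sup_normD (f g : CK) : sup_norm (f + g) <= sup_norm f + sup_norm g.
Proof.
apply: sup_norm_le => [|x]; first by rewrite addr_ge0 ?sup_norm_ge0.
by rewrite (le_trans (ler_normD _ _))// lerD ?le_sup_norm.
Qed.

Lemma sup_normZ_le (a : R) (f : CK) : sup_norm (a *: f) <= `|a| * sup_norm f.
Proof.
apply: sup_norm_le => [|x]; first by rewrite mulr_ge0 ?sup_norm_ge0.
by rewrite [X in `|X|](_ : _ = a * f x)// normrM ler_wpM2l ?le_sup_norm.
Qed.

Lemma sup_norm_eq0 (f : CK) : sup_norm f = 0 -> f = 0.
Proof.
move=> f0; apply/val_inj/funext => x; apply/eqP; rewrite -normr_le0.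
by rewrite -f0 le_sup_norm.
Qed.

Lemma sup_normZ (a : R) (f : CK) : sup_norm (a *: f) = `|a| * sup_norm f.
Proof.
apply/eqP; rewrite eq_le sup_normZ_le /=.
have [->|a0] := eqVneq a 0; first by rewrite normr0 mul0r sup_norm_ge0.
rewrite mulrC -ler_pdivlMr ?normr_gt0// mulrC -normfV.
by rewrite -[f in sup_norm f <= _](scalerK a0) sup_normZ_le.
Qed.

HB.instance Definition _ :=
  @Lmodule_isNormed.Build R CK sup_norm sup_normD sup_normZ sup_norm_eq0.

End continuous_functions.

(* The total variation [|nu|] of a charge, taken from a Hahn decomposition; on
   measurable sets it does not depend on the decomposition chosen. *)
Section total_variation.
Context d (T : measurableType d) (R : realType).
Implicit Type nu : {charge set T -> \bar R}.
Local Open Scope ereal_scope.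

Definition hahn_pos nu : set T := sval (cid (Hahn_decomposition nu)).
Definition hahn_neg nu : set T :=
  sval (cid (svalP (cid (Hahn_decomposition nu)))).

Lemma hahn_posneg nu : hahn_decomposition nu (hahn_pos nu) (hahn_neg nu).
Proof. exact: (svalP (cid (svalP (cid (Hahn_decomposition nu))))). Qed.

Definition total_variation nu : set T -> \bar R :=
  charge_variation (hahn_posneg nu).

HB.instance Definition _ nu := Measure.on (total_variation nu).

Lemma total_variation_fin nu A : measurable A ->
  total_variation nu A \is a fin_num.
Proof. by move=> mA; rewrite /total_variation fin_num_measure. Qed.

Lemma abse_le_total_variation nu A : measurable A ->
  `|nu A| <= total_variation nu A.
Proof. exact: abse_charge_variation. Qed.

Lemma total_variation_le nu (m : set T -> \bar R) :
  (forall A, measurable A -> `|nu A| <= m A) ->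
  (forall A B, measurable A -> measurable B -> A `&` B = set0 ->
     m (A `|` B) = m A + m B) ->
  forall A, measurable A -> total_variation nu A <= m A.
Proof.
move=> num mD A mA; have [[mP pP] [mN nN] PN PN0] := hahn_posneg nu.
have mAP : measurable (A `&` hahn_pos nu) by exact: measurableI.
have mAN : measurable (A `&` hahn_neg nu) by exact: measurableI.
rewrite -[in leRHS](setIT A) -PN setIUr mD//; last first.
  by rewrite setIACA PN0 setI0.
rewrite /total_variation /charge_variation /= jordan_posE jordan_negE.
rewrite cjordan_posE cjordan_negE /crestr0 mem_set// /crestr.
apply: leeD; first exact: le_trans (lee_abs _) (num _ mAP).
by rewrite (le_trans (lee_abs _))// abseN num.
Qed.

Lemma total_variation_lin (a : R) nu nu1 nu2 :
  (forall A, measurable A -> nu A = a%:E * nu1 A + nu2 A) ->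
  forall A, measurable A -> total_variation nu A <=
    `|a|%:E * total_variation nu1 A + total_variation nu2 A.
Proof.
move=> nuE; apply: total_variation_le => [A mA|A B mA mB AB0].
  rewrite nuE// (le_trans (lee_abs_add _ _))// abseM leeD//.
    by rewrite lee_wpmul2l// abse_le_total_variation.
  exact: abse_le_total_variation.
rewrite !measureU// ge0_muleDr// addeACA//.
Qed.

End total_variation.

(* C(K)^* as the space of regular signed Borel measures with the total
   variation norm.  As measurable types are pointed, K is nonempty. *)
Section regular_signed_measures.
Context (R : realType) (K : ptopologicalType).

Local Notation borel := (g_sigma_algebraType (@open K)).

(* On a compact Hausdorff space the closed sets [C] are the compact ones. *)
Definition regular (nu : {charge set borel -> \bar R}) : Prop :=
  forall A : set borel, measurable A -> forall e : R, 0 < e ->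
  exists C U : set K, [/\ closed C, open U, C `<=` A, A `<=` U &
    (total_variation nu (U `\` C) < e%:E)%E].

(* Charges are functions on all sets; a signed Borel measure is represented by
   its extension by 0 to the non-Borel sets, so that it is determined by its
   values on the Borel sets. *)
Definition rsm_pred : {pred set K -> R^o} := mem [set m : set K -> R^o |
  exists2 nu : {charge set borel -> \bar R}, regular nu &
    (forall A : set borel, measurable A -> (m A)%:E = nu A) /\
    (forall A : set borel, ~ measurable A -> m A = 0)].

Record rsm := RSM {
  rsm_fun :> set K -> R^o ;
  _ : rsm_fun \in rsm_pred }.

HB.instance Definition _ := [isSub for rsm_fun].
HB.instance Definition _ := [Choice of rsm by <:].

Lemma rsmP (mu : rsm) : exists2 nu : {charge set borel -> \bar R}, regular nu &
  (forall A : set borel, measurable A -> (mu A)%:E = nu A) /\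
  (forall A : set borel, ~ measurable A -> mu A = 0).
Proof. by case: mu => m mP; exact: (set_mem mP). Qed.

Definition rsm_charge (mu : rsm) : set borel -> \bar R := fun A => (mu A)%:E.

Section rsm_charge.
Variable mu : rsm.

Let rsm_charge0 : rsm_charge mu set0 = 0%E.
Proof.
by have [nu _ [nuE _]] := rsmP mu; rewrite /rsm_charge nuE// charge0.
Qed.

Let rsm_charge_fin A : measurable A -> rsm_charge mu A \is a fin_num.
Proof. by []. Qed.

Let rsm_charge_sigma_additive : semi_sigma_additive (rsm_charge mu).
Proof.
have [nu _ [nuE _]] := rsmP mu; move=> F mF tF mUF.
rewrite /rsm_charge nuE//; under eq_fun do under eq_bigr do rewrite nuE//.
exact: charge_semi_sigma_additive.
Qed.

HB.instance Definition _ := isCharge.Build _ _ _ (rsm_charge mu)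
  rsm_charge0 rsm_charge_fin rsm_charge_sigma_additive.

End rsm_charge.

Lemma total_variation_eq (nu1 nu2 : {charge set borel -> \bar R}) :
  (forall A, measurable A -> nu1 A = nu2 A) ->
  forall A, measurable A -> total_variation nu1 A = total_variation nu2 A.
Proof.
move=> E A mA; apply/eqP; rewrite eq_le; apply/andP; split.
  apply: total_variation_le => // [B mB|B C mB mC BC0].
    by rewrite E// abse_le_total_variation.
  by rewrite measureU.
apply: total_variation_le => // [B mB|B C mB mC BC0].
  by rewrite -E// abse_le_total_variation.
by rewrite measureU.
Qed.

Lemma regular_lin (a : R) (nu nu1 nu2 : {charge set borel -> \bar R}) :
  (forall A, measurable A -> nu A = (a%:E * nu1 A + nu2 A)%E) ->
  regular nu1 -> regular nu2 -> regular nu.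
Proof.
move=> nuE r1 r2 A mA e e0.
have b0 : 0 < `|a| + 1 by rewrite ltr_wpDl.
have d0 : 0 < e / 2 / (`|a| + 1) by rewrite !divr_gt0.
have [C1 [U1 [cC1 oU1 CA1 AU1 h1]]] := r1 A mA _ d0.
have [C2 [U2 [cC2 oU2 CA2 AU2 h2]]] := r2 A mA (e / 2) ltac:(by rewrite divr_gt0).
have mD (C U : set K) : closed C -> open U -> measurable (U `\` C : set borel).
  move=> cC oU; apply: measurableD; first exact: sub_sigma_algebra.
  rewrite -(setCK C); apply: measurableC; apply: sub_sigma_algebra.
  exact: closed_openC.
exists (C1 `|` C2), (U1 `&` U2); split.
- exact: closedU.
- exact: openI.
- by move=> x [/CA1|/CA2].
- by move=> x Ax; split; [exact: AU1|exact: AU2].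
have mm := mD _ _ (closedU cC1 cC2) (openI oU1 oU2).
apply: (le_lt_trans (total_variation_lin nuE mm)).
have l1 : (total_variation nu1 ((U1 `&` U2) `\` (C1 `|` C2)) <=
    total_variation nu1 (U1 `\` C1))%E.
  apply: le_measure; rewrite ?inE//; first exact: mD.
  by move=> x [[? ?] /not_orP[? ?]].
have l2 : (total_variation nu2 ((U1 `&` U2) `\` (C1 `|` C2)) <=
    total_variation nu2 (U2 `\` C2))%E.
  apply: le_measure; rewrite ?inE//; first exact: mD.
  by move=> x [[? ?] /not_orP[? ?]].
rewrite [e]splitr EFinD lee_ltD ?(le_lt_trans l2 h2)//.
  by rewrite fin_numM// total_variation_fin.
rewrite (le_trans (lee_wpmul2l _ (ltW (le_lt_trans l1 h1))))// -EFinM lee_fin.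
by rewrite mulrA ler_pdivrMr// mulrC ler_wpM2l ?lerDl// ltW// divr_gt0.
Qed.

Lemma total_variation_czero A : measurable A ->
  total_variation (@czero _ borel R) A = 0%E.
Proof.
move=> mA; apply/eqP; rewrite eq_le measure_ge0 andbT.
by apply: (total_variation_le (m := fun=> 0%E)) => // *; rewrite ?abse0 ?adde0.
Qed.

Lemma rsm_submod_closed : submod_closed rsm_pred.
Proof.
split.
  rewrite inE; exists (@czero _ borel R) => //.
  move=> A mA e e0; exists set0, setT; split=> //.
  - exact: closed0.
  - exact: openT.
  - by rewrite setD0 total_variation_czero.
move=> a m1 m2 /set_mem [nu1 r1 [e1 z1]] /set_mem [nu2 r2 [e2 z2]].
rewrite inE; exists (cadd (cscale a nu1) nu2).
  exact: (regular_lin (nu1 := nu1) (nu2 := nu2) (a := a)).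
split=> A mA; last by rewrite -[LHS]/(a * m1 A + m2 A) z1// z2// mulr0 addr0.
by rewrite -[LHS]/(a%:E * (m1 A)%:E + (m2 A)%:E)%E e1// e2.
Qed.

HB.instance Definition _ :=
  GRing.isSubmodClosed.Build _ _ rsm_pred rsm_submod_closed.
HB.instance Definition _ := [SubChoice_isSubLmodule of rsm by <:].

Definition variation (mu : rsm) : set borel -> \bar R :=
  total_variation (rsm_charge mu).

Definition variation_norm (mu : rsm) : R := fine (variation mu setT).

Lemma variation_norm_lin (a : R) (mu mu1 mu2 : rsm) :
  mu = a *: mu1 + mu2 ->
  variation_norm mu <= `|a| * variation_norm mu1 + variation_norm mu2.
Proof.
move=> ->; rewrite -lee_fin EFinD EFinM !fineK ?total_variation_fin//.
exact: total_variation_lin.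
Qed.

Lemma variation_norm_ge0 (mu : rsm) : 0 <= variation_norm mu.
Proof. by rewrite fine_ge0// measure_ge0. Qed.

Lemma variation_norm_eq0 (mu : rsm) : variation_norm mu = 0 -> mu = 0.
Proof.
move=> m0; apply/val_inj/funext => A.
have [mA|mA] := pselect (measurable (A : set borel)); last first.
  by have [nu _ [_ z]] := rsmP mu; exact: (z A mA).
apply/eqP; rewrite -normr_le0 -lee_fin.
have -> : (`|mu A|%:E = `|rsm_charge mu A|)%E by [].
apply: (le_trans (abse_le_total_variation _ mA)).
apply: (@le_trans _ _ (total_variation (rsm_charge mu) setT)).
  by apply: le_measure; rewrite ?inE.
by rewrite -[leLHS]fineK ?total_variation_fin// lee_fin -[fine _]/(variation_norm mu) m0.
Qed.

Lemma variation_norm0 : variation_norm 0 = 0.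
Proof.
apply/eqP; rewrite eq_le variation_norm_ge0 andbT -lee_fin fineK.
  apply: (total_variation_le (m := fun=> 0%E)) => // *; last by rewrite adde0.
  by rewrite abse0.
by rewrite total_variation_fin.
Qed.

Lemma variation_normD (mu1 mu2 : rsm) :
  variation_norm (mu1 + mu2) <= variation_norm mu1 + variation_norm mu2.
Proof.
have := @variation_norm_lin 1 (mu1 + mu2) mu1 mu2.
by rewrite scale1r normr1 mul1r; exact.
Qed.

Lemma variation_normZ (a : R) (mu : rsm) :
  variation_norm (a *: mu) = `|a| * variation_norm mu.
Proof.
have le b nu : variation_norm (b *: nu) <= `|b| * variation_norm nu.
  have := @variation_norm_lin b (b *: nu) nu 0.
  by rewrite addr0 variation_norm0 addr0; exact.
apply/eqP; rewrite eq_le le /=.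
have [->|a0] := eqVneq a 0; first by rewrite normr0 mul0r variation_norm_ge0.
rewrite mulrC -ler_pdivlMr ?normr_gt0// mulrC -normfV.
by rewrite -[mu in variation_norm mu <= _](scalerK a0) le.
Qed.

HB.instance Definition _ := @Lmodule_isNormed.Build R rsm variation_norm
  variation_normD variation_normZ variation_norm_eq0.

Definition lattice_norm (N : rsm -> R) : Prop :=
  forall mu nu : rsm,
    (forall A, measurable A -> (variation mu A <= variation nu A)%E) ->
    N mu <= N nu.

(* The integral of [f] against [mu], through the Jordan decomposition. *)
Definition rsm_integral (mu : rsm) (f : K -> R) : R :=
  \int[jordan_pos (hahn_posneg (rsm_charge mu))]_x f x -
  \int[jordan_neg (hahn_posneg (rsm_charge mu))]_x f x.

End regular_signed_measures.

(* [N] is the dual norm of an equivalent norm [p] of C(K), the duality between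
   C(K) and C(K)^* being given by integration. *)
Definition is_dual_norm (R : realType) (K : ptopologicalType)
    (cK : compact [set: K]) (N : rsm R K -> R) : Prop :=
  exists2 p : cspace R cK -> R, equivalent_norm p &
    forall mu, N mu = sup [set `|rsm_integral mu f| | f in [set f | p f <= 1]].

(* Main.v *)
(* In a Gruenhage space, the families can be replaced by countably many
   families of open sets such that the distinct members of each pairwise meet
   in the same set R, and such that the cells U \ R separate points; the
   families can also be closed under an operation that makes their cells a
   pi-system. For such a family, the numbers |mu|(U) - |mu|(R) are
   nonnegative with sum at most |mu|(K), so that all but few of them are
   small. Hence, if the supremum over m-element subfamilies F of the sum of
   |mu|(U)^2 (U in F) is almost the same at mu, at nu and at their midpoint,
   then the parallelogram law yields that |mu|(U) is close to |nu|(U) for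
   every member U, not only for those of a nearly optimal F. The square root
   of a weighted sum of these suprema is a dual norm, since mu |-> |mu|(U) is
   a supremum of integrals of continuous functions.

   If this norm is equal at mu, nu and their midpoint, then |mu|, |nu| and
   |mu + nu|/2 agree on all cells, hence everywhere by regularity, and mu =
   nu. With the positive parts of mu and -mu instead of |mu|, the same
   construction gives mu_n(U) - nu_n(U) -> 0 in the definition of pointwise
   uniform rotundity, and the evaluations at the members U separate measures. *)
From HB Require Import structures.
Require Import Defs.
From mathcomp Require Import all_boot all_order all_algebra.
From mathcomp Require Import all_classical all_reals all_analysis.
From mathcomp Require Import measurable_realfun ring lra.

Set Implicit Arguments.
Unset Strict Implicit.
Unset Printing Implicit Defensive.

Import Order.TTheory GRing.Theory Num.Theory.
Import numFieldNormedType.Exports.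

Local Open Scope classical_set_scope.
Local Open Scope ring_scope.

(** * Lower semicontinuous sublinear functionals *)

Section dual_sublinear.
Context (R : realType) (E V : lmodType R) (pair : E -> V -> R).

Definition bilinear_pairing :=
  [/\ forall f g v, pair (f + g) v = pair f v + pair g v,
      forall a f v, pair (a *: f) v = a * pair f v,
      forall f v w, pair f (v + w) = pair f v + pair f w &
      forall a f v, pair f (a *: v) = a * pair f v].

Hypothesis pairP : bilinear_pairing.

(* The nonnegative sublinear functionals that are lower semicontinuous for the
   weak topology induced by the pairing, as suprema of linear functionals. *)
Definition dual_sublinear (q : V -> R) :=
  (forall x, 0 <= q x) /\
  forall x t, t < q x -> exists f, t < pair f x /\ forall y, pair f y <= q y.

Implicit Type q : V -> R.

(** Every [pair f] below [q] is linear; if [q] exceeded the claimed bound, some such functional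
    would exceed it as well. Homogeneity below follows in the same way. *)
Lemma dual_sublinearD_le q x y : dual_sublinear q -> q (x + y) <= q x + q y.
Proof.
case: pairP => _ _ pD _ [q0 qP]; rewrite leNgt; apply/negP => /qP[f []].
by rewrite pD ltNge => /negP + fq; apply; rewrite lerD.
Qed.

Lemma dual_sublinear0 q : dual_sublinear q -> q 0 = 0.
Proof.
case: pairP => _ _ _ pZ [q0 qP]; apply/eqP; rewrite eq_le q0 andbT leNgt.
by apply/negP => /qP[f []]; rewrite -(scale0r (0 : V)) pZ mul0r ltxx.
Qed.

Lemma dual_sublinearZ q c x : dual_sublinear q -> 0 <= c ->
  q (c *: x) = c * q x.
Proof.
move=> dq; rewrite le_eqVlt => /predU1P[<-|c0].
  by rewrite scale0r dual_sublinear0// mul0r.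
have le b y : 0 < b -> q (b *: y) <= b * q y.
  case: pairP dq => _ _ _ pZ [q0 qP] b0.
  rewrite leNgt; apply/negP => /qP[f []]; rewrite pZ ltr_pM2l//.
  by rewrite ltNge => /negP + fq; apply.
apply/eqP; rewrite eq_le le//= mulrC -ler_pdivlMr// mulrC.
by rewrite -[x in q x <= _](scalerK (lt0r_neq0 c0)) le// invr_gt0.
Qed.

Lemma dual_sublinear_cst0 : dual_sublinear (fun=> 0).
Proof.
case: pairP => _ pZ _ _; split=> // x t t0; exists 0.
by rewrite -(scale0r (0 : E)); split=> [|y]; rewrite pZ mul0r.
Qed.

Lemma dual_sublinearD q1 q2 : dual_sublinear q1 -> dual_sublinear q2 ->
  dual_sublinear (fun x => q1 x + q2 x).
Proof.
case: pairP => pD _ _ _ [q10 q1P] [q20 q2P]; split=> [x|x t tq].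
  exact: addr_ge0.
have d0 : 0 < (q1 x + q2 x - t) / 2 by lra.
have [f [fx fq]] : exists f, q1 x - (q1 x + q2 x - t) / 2 < pair f x /\
    forall y, pair f y <= q1 y by apply: q1P; lra.
have [g [gx gq]] : exists f, q2 x - (q1 x + q2 x - t) / 2 < pair f x /\
    forall y, pair f y <= q2 y by apply: q2P; lra.
by exists (f + g); split=> [|y]; rewrite pD; [lra|exact: lerD].
Qed.

Lemma dual_sublinear_scale q c : dual_sublinear q -> 0 <= c ->
  dual_sublinear (fun x => c * q x).
Proof.
case: pairP => _ pZ _ _ [q0 qP] c0; split=> [x|x t].
  exact: mulr_ge0.
move: c0; rewrite le_eqVlt => /predU1P[<-|c0].
  rewrite mul0r => t0; have [_ /(_ x t t0)[f [tf fq]]] := dual_sublinear_cst0.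
  by exists f; split=> // y; rewrite mul0r.
rewrite mulrC -ltr_pdivrMr// => /qP[f [fx fq]]; exists (c *: f).
by rewrite pZ mulrC -ltr_pdivrMr//; split=> // y; rewrite pZ ler_pM2l.
Qed.

Lemma dual_sublinear_opp q : dual_sublinear q ->
  dual_sublinear (fun x => q (- x)).
Proof.
case: pairP => _ pZ _ pZr [q0 qP]; split=> // x t /qP[f [fx fq]].
have pN y : pair (- f) y = pair f (- y) by rewrite -scaleN1r pZ -pZr scaleN1r.
by exists (- f); rewrite pN; split=> // y; rewrite pN.
Qed.

Lemma dual_sublinear_sup q : (forall x, 0 <= q x) ->
  (forall x t, t < q x -> exists r,
     [/\ dual_sublinear r, t < r x & forall y, r y <= q y]) ->
  dual_sublinear q.
Proof.
move=> q0 qP; split=> // x t /qP[r [[r0 rP] /rP[f [tf fr]] rq]].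
by exists f; split=> // y; exact: le_trans (rq y).
Qed.

(** The Euclidean norm of [(q1 x, q2 x)] is the largest value of [a * q1 x + b * q2 x] over unit
    vectors [(a, b)], attained at the normalized vector itself. Its coordinates are nonnegative, so
    the combination is again dual sublinear. *)
Lemma dual_sublinear_hypot q1 q2 : dual_sublinear q1 -> dual_sublinear q2 ->
  dual_sublinear (fun x => Num.sqrt (q1 x ^+ 2 + q2 x ^+ 2)).
Proof.
move=> d1 d2; apply: dual_sublinear_sup => [x|x t tq]; first exact: sqrtr_ge0.
set s := Num.sqrt _ in tq.
have ss : s ^+ 2 = q1 x ^+ 2 + q2 x ^+ 2.
  by rewrite sqr_sqrtr// addr_ge0// sqr_ge0.
have [s0|s0] := eqVneq s 0.
  exists (fun=> 0); split=> [||y]; first exact: dual_sublinear_cst0.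
    by rewrite -s0.
  exact: sqrtr_ge0.
have sp : 0 < s by rewrite lt_neqAle eq_sym s0 sqrtr_ge0.
have c1 : 0 <= q1 x / s by rewrite divr_ge0 ?(ltW sp)//; case: d1.
have c2 : 0 <= q2 x / s by rewrite divr_ge0 ?(ltW sp)//; case: d2.
exists (fun y => q1 x / s * q1 y + q2 x / s * q2 y); split=> [||y].
- by apply: dual_sublinearD; exact: dual_sublinear_scale.
- suff -> : q1 x / s * q1 x + q2 x / s * q2 x = s by [].
  by rewrite mulrAC (mulrAC (q2 x)) -mulrDl -!expr2 -ss expr2 mulfK.
- have [q10 q20] : 0 <= q1 y /\ 0 <= q2 y by case: d1; case: d2.
  rewrite -[leLHS]ger0_norm; last by rewrite addr_ge0// mulr_ge0.
  rewrite -sqrtr_sqr ler_sqrt; last by rewrite addr_ge0// sqr_ge0.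
  have cc : (q1 x / s) ^+ 2 + (q2 x / s) ^+ 2 = 1.
    by rewrite !expr_div_n -mulrDl -ss divff// expf_neq0.
  move: cc; set a := q1 x / s; set b := q2 x / s => cc.
  rewrite -subr_ge0 -[X in X - _]mul1r -cc.
  (* Cauchy-Schwarz, by Lagrange's identity. *)
  have -> : (a ^+ 2 + b ^+ 2) * (q1 y ^+ 2 + q2 y ^+ 2) -
    (a * q1 y + b * q2 y) ^+ 2 = (a * q2 y - b * q1 y) ^+ 2 by ring.
  exact: sqr_ge0.
Qed.

Lemma dual_sublinear_l2 (I : Type) (q : I -> V -> R) (s : seq I) :
  (forall i, dual_sublinear (q i)) ->
  dual_sublinear (fun x => Num.sqrt (\sum_(i <- s) q i x ^+ 2)).
Proof.
move=> dq; elim: s => [|i s ih].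
  under eq_fun do rewrite big_nil sqrtr0; exact: dual_sublinear_cst0.
have /= := dual_sublinear_hypot (dq i) ih; congr (dual_sublinear _).
apply/funext => x; rewrite big_cons sqr_sqrtr//.
by rewrite sumr_ge0// => j _; exact: sqr_ge0.
Qed.

Lemma dual_sublinear_half q x y : dual_sublinear q ->
  q (2^-1 *: (x + y)) <= (q x + q y) / 2.
Proof.
move=> dq; rewrite dual_sublinearZ// mulrC ler_pM2r//.
exact: dual_sublinearD_le.
Qed.

(** As [q] is convex and nonnegative, its square is convex; this makes the defects in the
    parallelogram arguments nonnegative. *)
Lemma dual_sublinear_half_sqr q x y : dual_sublinear q ->
  q (2^-1 *: (x + y)) ^+ 2 <= (q x ^+ 2 + q y ^+ 2) / 2.
Proof.
move=> dq; have := dual_sublinear_half x y dq; case: dq => q0 _.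
have := q0 (2^-1 *: (x + y)).
move: (q _) (q x) (q y) => h a b h0 hab.
have : h ^+ 2 <= ((a + b) / 2) ^+ 2 by rewrite ler_sqr ?nnegrE//; lra.
move=> /le_trans; apply; have := sqr_ge0 (a - b); nra.
Qed.

End dual_sublinear.

(** * Rotundity of norms built from families of functionals *)

Section top_norm.
Context (R : realType) (E V : lmodType R) (pair : E -> V -> R).
Hypothesis pairP : bilinear_pairing pair.
Context (I : choiceType) (g : I -> V -> R) (nV : V -> R).
(** In the application the indices are sets, [r] is the root of an almost disjoint family, [A]
    consists of its members, and [gsum_le] expresses that the cells are disjoint. *)
Context (r : I) (A : set I).

Hypothesis dg : forall i, dual_sublinear pair (g i).
Hypothesis g_le : forall x i, i = r \/ A i -> g i x <= nV x.
Hypothesis gr_le : forall x i, A i -> g r x <= g i x.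
Hypothesis gsum_le : forall x (s : seq I), uniq s -> {in s, forall i, A i} ->
  \sum_(i <- s) (g i x - g r x) <= nV x.

Let g_ge0 i x : 0 <= g i x. Proof. by case: (dg i). Qed.

Definition top_index (m : nat) (s : seq I) :=
  [/\ uniq s, {in s, forall i, A i} & (size s <= m)%N].

(** The term of [r] is always included, so that near-optimality controls it too. *)
Definition top_sqr (m : nat) (x : V) : R :=
  sup [set g r x ^+ 2 + \sum_(i <- s) g i x ^+ 2 | s in top_index m].

Lemma top_sqr_sum_le m s x : top_index m s ->
  g r x ^+ 2 + \sum_(i <- s) g i x ^+ 2 <= m.+1%:R * nV x ^+ 2.
Proof.
move=> [us sA sm]; rewrite -natr1 mulrDl mul1r addrC.
have le i : i = r \/ A i -> g i x ^+ 2 <= nV x ^+ 2.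
  by move=> /(g_le x) le; rewrite ler_sqr ?nnegrE ?(le_trans (g_ge0 i x) le).
apply: lerD; last by apply: le; left.
apply: (@le_trans _ _ (\sum_(i <- s) nV x ^+ 2)).
  by rewrite !big_seq ler_sum// => i /sA Ai; apply: le; right.
rewrite big_const_seq count_predT iter_addr_0 -[leLHS]mulr_natl.
by rewrite ler_wpM2r ?sqr_ge0// ler_nat.
Qed.

Let top_has_sup m x :
  has_sup [set g r x ^+ 2 + \sum_(i <- s) g i x ^+ 2 | s in top_index m].
Proof.
split; first by exists (g r x ^+ 2 + \sum_(i <- [::]) g i x ^+ 2); exists [::].
by exists (m.+1%:R * nV x ^+ 2) => _ [s ms <-]; exact: top_sqr_sum_le.
Qed.

Lemma le_top_sqr m s x : top_index m s ->
  g r x ^+ 2 + \sum_(i <- s) g i x ^+ 2 <= top_sqr m x.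
Proof. by move=> ms; apply: sup_upper_bound => //; exists s. Qed.

Lemma top_sqr_ge0 m x : 0 <= top_sqr m x.
Proof.
apply: (le_trans _ (@le_top_sqr m [::] x _)) => //.
by rewrite big_nil addr0 sqr_ge0.
Qed.

Lemma top_sqr_le m x : top_sqr m x <= m.+1%:R * nV x ^+ 2.
Proof.
apply: ge_sup => [|_ [s ms <-]]; last exact: top_sqr_sum_le.
by case: (top_has_sup m x).
Qed.

Definition top_norm m x := Num.sqrt (top_sqr m x).

Lemma top_norm_sqr m x : top_norm m x ^+ 2 = top_sqr m x.
Proof. by rewrite sqr_sqrtr// top_sqr_ge0. Qed.

Lemma dual_sublinear_top_norm m : dual_sublinear pair (top_norm m).
Proof.
apply: dual_sublinear_sup => [x|x t tq]; first exact: sqrtr_ge0.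
have [s [ms ts]] : exists s, top_index m s /\
    t < Num.sqrt (\sum_(i <- r :: s) g i x ^+ 2).
  have [t0|t0] := ltP t 0.
    by exists [::]; split=> //; exact: lt_le_trans (sqrtr_ge0 _).
  have ttop : t ^+ 2 < top_sqr m x.
    by rewrite -top_norm_sqr ltr_sqr ?nnegrE// sqrtr_ge0.
  have [_ [s ms <-] ts] := sup_gt (proj1 (top_has_sup m x)) ttop.
  exists s; split=> //; rewrite big_cons -(ger0_norm t0) -sqrtr_sqr.
  by rewrite ltr_sqrt// (le_lt_trans _ ts)// sqr_ge0.
exists (fun x => Num.sqrt (\sum_(i <- r :: s) g i x ^+ 2)); split=> // [|y].
  exact: (dual_sublinear_l2 pairP).
by rewrite ler_sqrt ?top_sqr_ge0// big_cons le_top_sqr.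
Qed.

(* If [r :: s] almost attains the supremum defining [top_sqr] at the midpoint,
   then the parallelogram law controls [g i x - g i y] for [i] in [r :: s].  Any
   other [i] can be exchanged for some [j] in [s] with [g j x] close to [g r x],
   which exists since [s] has [m] elements. *)
Lemma top_norm_uniform m x y (C t : R) : (0 < m)%N -> 0 <= t ->
  nV x <= C -> nV y <= C ->
  (top_sqr m x + top_sqr m y) / 2 - top_sqr m (2^-1 *: (x + y)) < t ^+ 2 ->
  forall i, i = r \/ A i -> `|g i x - g i y| <= C / m%:R + 4 * t.
Proof.
move=> m0 t0 xC yC def.
set z := 2^-1 *: (x + y) in def.
have [_ [s ms <-] zs] : exists2 u, [set g r z ^+ 2 + \sum_(i <- s) g i z ^+ 2 |
    s in top_index m] u & (top_sqr m x + top_sqr m y) / 2 - t ^+ 2 < u.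
  by apply: sup_gt; [case: (top_has_sup m z)|rewrite -/(top_sqr m z); lra].
have C0 : 0 <= C.
  by apply: le_trans xC; apply: le_trans (g_le x (or_introl erefl)).
have e0 : 0 <= C / m%:R by rewrite divr_ge0.
have mid : \sum_(i <- r :: s) g i z ^+ 2 <=
    \sum_(i <- r :: s) ((g i x + g i y) / 2) ^+ 2.
  apply: ler_sum => i _; rewrite ler_sqr ?nnegrE ?divr_ge0 ?addr_ge0//.
  exact: (dual_sublinear_half pairP x y (dg i)).
have par : \sum_(i <- r :: s) ((g i x + g i y) / 2) ^+ 2 +
    \sum_(i <- r :: s) ((g i x - g i y) / 2) ^+ 2 =
    (\sum_(i <- r :: s) g i x ^+ 2 + \sum_(i <- r :: s) g i y ^+ 2) / 2.
  rewrite -!big_split/= mulr_suml; apply: eq_bigr => i _.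
  by field.
have xs : \sum_(i <- r :: s) g i x ^+ 2 <= top_sqr m x.
  by rewrite big_cons le_top_sqr.
have ys : \sum_(i <- r :: s) g i y ^+ 2 <= top_sqr m y.
  by rewrite big_cons le_top_sqr.
have {}zs : (top_sqr m x + top_sqr m y) / 2 - t ^+ 2 <
    \sum_(i <- r :: s) g i z ^+ 2 by rewrite big_cons.
have dif0 : 0 <= \sum_(i <- r :: s) ((g i x - g i y) / 2) ^+ 2.
  by apply: sumr_ge0 => i _; exact: sqr_ge0.
have bounds (a b c d e f f' t' : R) : (f + f') / 2 - t' < a -> a <= b ->
    b + c = (d + e) / 2 -> 0 <= c -> d <= f -> e <= f' ->
    [/\ c <= t', f - 2 * t' <= d & f' - 2 * t' <= e] by move=> *; split; lra.
have [dif xs2 ys2] := bounds _ _ _ _ _ _ _ _ zs mid par dif0 xs ys.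
have close i : i \in r :: s -> `|g i x - g i y| <= 2 * t.
  move=> irs; have : ((g i x - g i y) / 2) ^+ 2 <= t ^+ 2.
    apply: le_trans dif; rewrite (big_rem i)//= lerDl sumr_ge0// => j _.
    exact: sqr_ge0.
  rewrite -ler_sqrt ?sqr_ge0// !sqrtr_sqr (ger0_norm t0) normrM.
  by rewrite [X in _ * X]gtr0_norm//; lra.
have far u i : A i -> i \notin s -> nV u <= C ->
    top_sqr m u - 2 * t ^+ 2 <= \sum_(i <- r :: s) g i u ^+ 2 ->
    g i u <= g r u + C / m%:R + 2 * t.
  case: ms => us sA sm Ai si uC us2.
  have bd v : g i u ^+ 2 <= v ^+ 2 + 2 * t ^+ 2 -> 0 <= v -> g i u <= v + 2 * t.
    move=> h v0; rewrite -ler_sqr ?nnegrE ?addr_ge0 ?mulr_ge0//.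
    by apply: (le_trans h); nra.
  move: sm; rewrite leq_eqVlt => /predU1P[sm|sm].
    (* If [s] is full, some [j] in [s] is close to the root, for otherwise the differences would sum
       to more than [C]. *)
    have [j js jC] : exists2 j, j \in s & g j u <= g r u + C / m%:R.
      apply: contrapT => /forall2NP nj.
      have : C < \sum_(j <- s) (g j u - g r u).
        rewrite [ltLHS](_ : C = \sum_(j <- s) C / m%:R); last first.
          rewrite big_const_seq count_predT iter_addr_0 sm.
          rewrite -[RHS]mulr_natr divfK//.
          by rewrite pnatr_eq0 -lt0n.
        rewrite big_seq [ltRHS]big_seq; apply: ltr_sum => [|j js].
          case: (s) sm m0 => [<-//|j s' _ _].
          by apply/hasP; exists j; rewrite ?mem_head.
        by case: (nj j) => [//|/negP]; rewrite -ltNge; lra.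
      by rewrite ltNge (le_trans (gsum_le _ us sA)).
    have rj : top_index m (i :: rem j s).
      split=> /=; first by rewrite rem_uniq// andbT (contra (@mem_rem _ j s i)).
        by move=> k; rewrite inE => /predU1P[->//|/mem_rem /sA].
      by rewrite size_rem// prednK// sm.
    have := le_top_sqr u rj; rewrite big_cons.
    move: us2; rewrite big_cons (big_rem j)//= => us2 h.
    have j2 : g j u ^+ 2 <= (g r u + C / m%:R) ^+ 2.
      by rewrite ler_sqr ?nnegrE ?addr_ge0.
    apply: bd; last by rewrite addr_ge0.
    apply: le_trans (lerD j2 (lexx _)).
    move: us2 h; set S := \sum_(_ <- _) _; clearbody S; lra.
  (* If [s] has room left, [i] can simply be added, so that [g i u ^+ 2] is at most [2 * t ^+ 2]. *)
  have rj : top_index m (i :: s).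
    by split=> [|k|]//=; [rewrite si|rewrite inE => /predU1P[->//|/sA]].
  have := le_top_sqr u rj; rewrite big_cons => h.
  move: us2; rewrite big_cons => us2.
  have /bd : g i u ^+ 2 <= 0 ^+ 2 + 2 * t ^+ 2 by rewrite expr0n/=; lra.
  by move=> /(_ (lexx 0)); have := g_ge0 r u; lra.
have := close r (mem_head _ _); rewrite ler_norml => /andP[r1 r2].
move=> i iA; have [irs|] := boolP (i \in r :: s).
  by apply: (le_trans (close i irs)); lra.
rewrite inE negb_or => /andP[/eqP ir si].
have Ai : A i by case: iA.
(* Passing from [i] at one point to the root there, to the root at the other point and up to [i]
   again costs [C / m%:R + 2 * t], then [2 * t], then nothing. *)
have := far x i Ai si xC xs2; have := far y i Ai si yC ys2.
have := gr_le x Ai; have := gr_le y Ai.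
by rewrite ler_norml => *; apply/andP; split; lra.
Qed.

End top_norm.

(** * Square-summable series of sublinear functionals *)

Section l2_series.
Context (R : realType) (E V : lmodType R) (pair : E -> V -> R).
Hypothesis pairP : bilinear_pairing pair.
Context (q : nat -> V -> R) (nV : V -> R).
Hypothesis dq : forall k, dual_sublinear pair (q k).
Hypothesis q_le : forall k x, q k x ^+ 2 <= nV x ^+ 2 / (2 ^ k.+1)%:R.

Definition l2_sqr (x : V) : R := limn (series (fun k => q k x ^+ 2)).

Let nd x : {homo series (fun k => q k x ^+ 2) : m n / (m <= n)%N >-> m <= n}.
Proof. by apply: nondecreasing_series => k _ _; exact: sqr_ge0. Qed.

Lemma l2_partial_le n x : series (fun k => q k x ^+ 2) n <= nV x ^+ 2.
Proof.
(* The first [n] weights [1 / 2 ^ k.+1] add up to [1 - 1 / 2 ^ n]. *)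
have : series (fun k => q k x ^+ 2) n <= nV x ^+ 2 * (1 - (2 ^ n)%:R^-1).
  elim: n => [|n ih].
    by rewrite /series/= big_geq// expn0 invr1 subrr mulr0.
  rewrite seriesSr/=; apply: le_trans (lerD ih (q_le n x)) _.
  rewrite expnS natrM.
  have : (2 ^ n)%:R != 0 :> R by rewrite pnatr_eq0 -lt0n expn_gt0.
  set p := (2 ^ n)%:R => p0; rewrite le_eqVlt; apply/orP; left; apply/eqP.
  by field.
move=> /le_trans; apply; by rewrite ler_piMr ?sqr_ge0// gerBl.
Qed.

Lemma cvg_l2_series x : cvgn (series (fun k => q k x ^+ 2)).
Proof.
apply: nondecreasing_is_cvgn; first exact: nd.
by exists (nV x ^+ 2) => _ [n _ <-]; exact: l2_partial_le.
Qed.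

Lemma le_l2_sqr n x : series (fun k => q k x ^+ 2) n <= l2_sqr x.
Proof. exact: nondecreasing_cvgn_le (@nd x) (@cvg_l2_series x) n. Qed.

Lemma l2_sqr_ge k x : q k x ^+ 2 <= l2_sqr x.
Proof.
apply: le_trans (le_l2_sqr k.+1 x).
rewrite seriesSr/= lerDr /series/= sumr_ge0// => i _; exact: sqr_ge0.
Qed.

Lemma l2_sqr_ge0 x : 0 <= l2_sqr x.
Proof. exact: le_trans (sqr_ge0 _) (l2_sqr_ge 0 x). Qed.

Lemma l2_sqr_le x : l2_sqr x <= nV x ^+ 2.
Proof.
apply: limr_le; first exact: cvg_l2_series.
by apply: nearW => n; exact: l2_partial_le.
Qed.

Definition l2_norm x := Num.sqrt (l2_sqr x).

Lemma l2_norm_sqr x : l2_norm x ^+ 2 = l2_sqr x.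
Proof. by rewrite sqr_sqrtr ?l2_sqr_ge0. Qed.

Lemma dual_sublinear_l2_norm : dual_sublinear pair l2_norm.
Proof.
apply: dual_sublinear_sup => [x|x t tq]; first exact: sqrtr_ge0.
have [n tn] : exists n, t < Num.sqrt (series (fun k => q k x ^+ 2) n).
  have [t0|t0] := ltP t 0; first by exists 0; exact: lt_le_trans (sqrtr_ge0 _).
  have tS : t ^+ 2 < l2_sqr x.
    by rewrite -l2_norm_sqr ltr_sqr ?nnegrE// sqrtr_ge0.
  apply: contrapT => /forallNP nt; move: tS; apply/negP; rewrite -leNgt.
  apply: limr_le; [exact: cvg_l2_series|apply: nearW => n].
  have /negP := nt n; rewrite -leNgt -(ler_sqr (R:=R)) ?nnegrE ?sqrtr_ge0//.
  by rewrite sqr_sqrtr// sumr_ge0// => k _; exact: sqr_ge0.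
exists (fun x => Num.sqrt (series (fun k => q k x ^+ 2) n)); split=> // [|y].
  exact: (dual_sublinear_l2 pairP).
by rewrite ler_sqrt ?l2_sqr_ge0// le_l2_sqr.
Qed.

(** The defect of the series is the sum of the defects of its terms, all nonnegative by convexity,
    so a single one is at most the total. *)
Lemma l2_sqr_defect k x y :
  (q k x ^+ 2 + q k y ^+ 2) / 2 - q k (2^-1 *: (x + y)) ^+ 2 <=
  (l2_sqr x + l2_sqr y) / 2 - l2_sqr (2^-1 *: (x + y)).
Proof.
set z := 2^-1 *: (x + y).
pose u n :=
  (series (fun k => q k x ^+ 2) n + series (fun k => q k y ^+ 2) n) / 2 -
  series (fun k => q k z ^+ 2) n.
have cu : u @ \oo --> (l2_sqr x + l2_sqr y) / 2 - l2_sqr z.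
  apply: cvgB; last exact: cvg_l2_series.
  by apply: cvgMl; apply: cvgD; exact: cvg_l2_series.
have uS n : u n.+1 =
    u n + ((q n x ^+ 2 + q n y ^+ 2) / 2 - q n z ^+ 2).
  by rewrite /u !seriesSr/=; field.
have d0 n : 0 <= (q n x ^+ 2 + q n y ^+ 2) / 2 - q n z ^+ 2.
  by rewrite subr_ge0 (dual_sublinear_half_sqr pairP).
have ndu : nondecreasing_seq u.
  by apply/nondecreasing_seqP => n; rewrite uS lerDl.
have u0 n : 0 <= u n.
  by elim: n => [|n ih]; [rewrite /u /series/= !big_geq// addr0 mul0r subr0|
    rewrite uS addr_ge0].
rewrite -(cvg_lim _ cu)//; apply: le_trans (nondecreasing_cvgn_le ndu _ k.+1).
  by rewrite uS lerDr.
by apply/cvg_ex; eexists; exact: cu.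
Qed.

End l2_series.

Lemma defect_split (R : realFieldType) (a a' b b' c c' u : R) :
  c <= (a + b) / 2 -> c' <= (a' + b') / 2 ->
  (a + a' + (b + b')) / 2 - (c + c') < u ->
  (a + b) / 2 - c < u /\ (a' + b') / 2 - c' < u.
Proof. by move=> *; split; lra. Qed.

(** * The norm of a countable collection of families of functionals *)

Section family_norm.
Context (R : realType) (E V : lmodType R) (pair : E -> V -> R).
Hypothesis pairP : bilinear_pairing pair.
Context (I : choiceType) (g : I -> V -> R) (nV : V -> R).
Context (J : countType) (r : J -> I) (A : J -> set I).

Hypothesis nVN : forall x, nV (- x) = nV x.
Hypothesis dg : forall i, dual_sublinear pair (g i).
Hypothesis g_le : forall j x i, i = r j \/ A j i -> g i x <= nV x.
Hypothesis gr_le : forall j x i, A j i -> g (r j) x <= g i x.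
Hypothesis gsum_le : forall j x (s : seq I), uniq s ->
  {in s, forall i, A j i} -> \sum_(i <- s) (g i x - g (r j) x) <= nV x.

Local Notation top p := (top_norm g (r p.1) (A p.1) p.2).

Let dtop (p : J * nat) : dual_sublinear pair (top p).
Proof.
apply: (dual_sublinear_top_norm pairP dg (g_le (j := p.1))).
Qed.

(** Using [- x] as well makes the norm even and lets it see both parts of a signed measure. *)
Definition level_norm (p : J * nat) x :=
  Num.sqrt (top p x ^+ 2 + top p (- x) ^+ 2).

(** The square of the weight cancels the bound [p.2.+1] of [top_sqr_le] and the factor 2 from the
    two terms of [level_norm], and leaves [1 / 2 ^ k.+1]. *)
Definition level_weight k (p : J * nat) : R :=
  Num.sqrt ((2 * (2 ^ k.+1 * p.2.+1)%:R)^-1).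

(** The pairs of a family and a length are enumerated by [unpickle]; a [k] that encodes no pair
    contributes 0. *)
Definition level_term k x : R :=
  if unpickle k is Some p then level_weight k p * level_norm p x else 0.

Definition family_norm := l2_norm level_term.

Let level_sqr p x : level_norm p x ^+ 2 = top p x ^+ 2 + top p (- x) ^+ 2.
Proof. by rewrite sqr_sqrtr// addr_ge0// sqr_ge0. Qed.

Let weight_gt0 k p : 0 < level_weight k p.
Proof. by rewrite sqrtr_gt0 invr_gt0 mulr_gt0// ltr0n muln_gt0 expn_gt0. Qed.

Let dlevel p : dual_sublinear pair (level_norm p).
Proof.
apply: (dual_sublinear_hypot pairP); first exact: dtop.
exact: (dual_sublinear_opp pairP (dtop p)).
Qed.

Let dterm k : dual_sublinear pair (level_term k).
Proof.
rewrite /level_term; case: unpickle => [p|]; last exact: dual_sublinear_cst0.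
by apply: dual_sublinear_scale => //; exact: ltW.
Qed.

Let term_le k x : level_term k x ^+ 2 <= nV x ^+ 2 / (2 ^ k.+1)%:R.
Proof.
rewrite /level_term; case: unpickle => [p|]; last first.
  by rewrite expr0n/= divr_ge0// sqr_ge0.
rewrite exprMn level_sqr sqr_sqrtr; last first.
  by rewrite invr_ge0 mulr_ge0.
have le y : top p y ^+ 2 <= p.2.+1%:R * nV y ^+ 2.
  rewrite (top_norm_sqr dg (g_le (j := p.1))).
  exact: (top_sqr_le dg (g_le (j := p.1))).
have := lerD (le x) (le (- x)); rewrite nVN -mulr2n -mulr_natl => h.
rewrite mulrC ler_pdivrMr; last by rewrite mulr_gt0// ltr0n muln_gt0 expn_gt0.
apply: (le_trans h); rewrite natrM.
have : (2 ^ k.+1)%:R != 0 :> R by rewrite pnatr_eq0 -lt0n expn_gt0.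
set a := (2 ^ k.+1)%:R => a0; rewrite le_eqVlt; apply/orP; left; apply/eqP.
by field.
Qed.

Lemma dual_sublinear_family_norm : dual_sublinear pair family_norm.
Proof. exact: (dual_sublinear_l2_norm pairP dterm term_le). Qed.

Let family_norm_sqr x : family_norm x ^+ 2 = l2_sqr level_term x.
Proof. exact: (l2_norm_sqr term_le). Qed.

Lemma family_normN x : family_norm (- x) = family_norm x.
Proof.
rewrite /family_norm /l2_norm /l2_sqr; congr (Num.sqrt (limn (series _))).
apply/funext => k; rewrite /level_term; case: unpickle => [p|//].
by rewrite /level_norm opprK addrC.
Qed.

Hypothesis nV_ge0 : forall x, 0 <= nV x.

Lemma family_norm_le x : family_norm x <= nV x.
Proof.
rewrite -(ger0_norm (nV_ge0 x)) -sqrtr_sqr ler_sqrt ?sqr_ge0//.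
exact: (l2_sqr_le term_le).
Qed.

Let top_ge j i x : i = r j \/ A j i -> g i x ^+ 2 <= top (j, 1%N) x ^+ 2.
Proof.
rewrite (top_norm_sqr dg (g_le (j := j)))/= => -[->|Ai].
  apply: le_trans (le_top_sqr dg (g_le (j := j)) x (s := [::]) _) => //.
  by rewrite big_nil addr0.
apply: le_trans (le_top_sqr dg (g_le (j := j)) x (s := [:: i]) _).
  by rewrite big_seq1 lerDr sqr_ge0.
by split=> // k; rewrite inE => /eqP ->.
Qed.

(** One term of the series suffices, that of [j] with lists of length at most 1: it dominates the
    squares of [g i x] and [g i (- x)]. *)
Lemma family_norm_ge j i : i = r j \/ A j i ->
  (forall x, nV x <= g i x + g i (- x)) ->
  exists2 c : R, 0 < c & forall x, c * nV x <= family_norm x.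
Proof.
move=> ij nVg; pose k := pickle (j, 1%N); pose w := level_weight k (j, 1%N).
have w0 : 0 < w by exact: weight_gt0.
exists (w / 2) => [|x]; first by rewrite divr_gt0.
rewrite -ler_sqr ?nnegrE ?mulr_ge0 ?sqrtr_ge0 ?divr_ge0 ?(ltW w0)//.
rewrite family_norm_sqr; apply: le_trans (l2_sqr_ge term_le k x).
rewrite /level_term pickleK -/w exprMn exprMn exprMn -mulrA.
rewrite ler_pM2l ?exprn_gt0//.
rewrite level_sqr; have := top_ge x ij; have := top_ge (- x) ij.
have := nVg x; have := nV_ge0 x.
set n := nV x; set a := g i x; set b := g i (- x) => n0 nab b2 a2.
apply: le_trans (lerD a2 b2).
have : n ^+ 2 <= (a + b) ^+ 2 by rewrite ler_sqr ?nnegrE// (le_trans n0).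
have -> : 2^-1 ^+ 2 * n ^+ 2 = n ^+ 2 / 4 by field.
have := sqr_ge0 (a - b); have : 0 <= n ^+ 2 by exact: sqr_ge0.
have -> : (a + b) ^+ 2 = a ^+ 2 + b ^+ 2 + 2 * (a * b) by ring.
have -> : (a - b) ^+ 2 = a ^+ 2 + b ^+ 2 - 2 * (a * b) by ring.
by move: (n ^+ 2) (a ^+ 2) (b ^+ 2) (a * b) => *; lra.
Qed.

Lemma family_norm_mono x y :
  (forall j i, i = r j \/ A j i -> g i x <= g i y /\ g i (- x) <= g i (- y)) ->
  family_norm x <= family_norm y.
Proof.
move=> gxy; rewrite /family_norm /l2_norm ler_sqrt ?(l2_sqr_ge0 term_le)//.
have top_le p u v : (forall i, i = r p.1 \/ A p.1 i -> g i u <= g i v) ->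
    top p u ^+ 2 <= top p v ^+ 2.
  move=> guv; rewrite !(top_norm_sqr dg (g_le (j := p.1))).
  have guv2 i : i = r p.1 \/ A p.1 i -> g i u ^+ 2 <= g i v ^+ 2.
    by move=> /guv guvi; rewrite ler_sqr ?nnegrE//; case: (dg i).
  apply: ge_sup => [|_ [s ms <-]].
    by exists (g (r p.1) u ^+ 2 + \sum_(i <- [::]) g i u ^+ 2); exists [::].
  apply: le_trans (le_top_sqr dg (g_le (j := p.1)) v ms); apply: lerD.
    by apply: guv2; left.
  rewrite !big_seq; apply: ler_sum => i is_; apply: guv2; right.
  by case: ms => _ + _; apply.
apply: ler_lim; try exact: (cvg_l2_series term_le).
apply: nearW => n.
apply: ler_sum => k _; rewrite /level_term; case: unpickle => [p|//].
rewrite !exprMn !level_sqr ler_pM2l ?exprn_gt0//.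
by apply: lerD; apply: top_le => i /gxy[].
Qed.

Lemma family_norm_uniform j i (C e : R) : i = r j \/ A j i -> 0 < e ->
  exists2 d : R, 0 < d & forall x y, nV x <= C -> nV y <= C ->
    (family_norm x ^+ 2 + family_norm y ^+ 2) / 2 -
      family_norm (2^-1 *: (x + y)) ^+ 2 < d ->
    `|g i x - g i y| <= e /\ `|g i (- x) - g i (- y)| <= e.
Proof.
(* The bound [C / m + 4 * t] of [top_norm_uniform] is split evenly: first [t] is chosen, then
   [m]. *)
move=> ij e0; have [t t0 te] : exists2 t : R, 0 < t & 4 * t = e / 2.
  by exists (e / 8); [rewrite divr_gt0|field].
have [m Cm] : exists m, C / m.+1%:R + 4 * t <= e.
  exists (Num.truncn (2 * C / e)); rewrite te -lerBrDr ler_pdivrMr ?ltr0n//.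
  have := Num.Theory.truncnS_gt (2 * C / e); rewrite ltr_pdivrMr//.
  move: ((Num.truncn _).+1%:R) => M.
  have -> : (e - e / 2) * M = M * e / 2 by field.
  by move: (M * e) => eM; lra.
have [p pE] : exists p : J * nat, p = (j, m.+1) by exists (j, m.+1).
have [k kE] : exists k, unpickle k = Some p.
  by exists (pickle p); rewrite pickleK.
have [w w0 wE] : exists2 w : R, 0 < w & level_weight k p = w.
  by exists (level_weight k p); first exact: weight_gt0.
(* The term with code [k] has as its defect [w ^+ 2] times the sum of the defects of [top p] at
   [x, y] and at [- x, - y]. *)
exists (w ^+ 2 * t ^+ 2) => [|x y xC yC]; first by rewrite mulr_gt0 ?exprn_gt0.
move=> def.
have := l2_sqr_defect pairP dterm term_le k x y; rewrite -!family_norm_sqr.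
move=> /le_lt_trans /(_ def).
rewrite /level_term kE wE !exprMn -mulrDr -mulrA -mulrBr ltr_pM2l ?exprn_gt0//.
rewrite !level_sqr -scalerN (opprD x y).
have d1 := dual_sublinear_half_sqr pairP x y (dtop p).
have d2 := dual_sublinear_half_sqr pairP (- x) (- y) (dtop p).
move=> h; have [] := defect_split d1 d2 h.
rewrite !(top_norm_sqr dg (g_le (j := p.1))) pE/= => h1 h2.
split.
  apply: le_trans Cm.
  exact: (top_norm_uniform pairP dg (g_le (j := j)) (gr_le (j := j))
    (gsum_le (j := j)) (ltn0Sn _) (ltW t0) xC yC h1).
apply: le_trans Cm.
have xC' : nV (- x) <= C by rewrite nVN.
have yC' : nV (- y) <= C by rewrite nVN.
exact: (top_norm_uniform pairP dg (g_le (j := j)) (gr_le (j := j))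
  (gsum_le (j := j)) (ltn0Sn _) (ltW t0) xC' yC' h2).
Qed.

End family_norm.

(** * Almost disjoint families of open sets *)

Section set_families.
Context (X : topologicalType).

(* A family of sets [F.2] whose members pairwise meet in the set [F.1]. *)
Definition set_family : Type := set X * set (set X).

Definition almost_disjoint (F : set_family) : Prop :=
  [/\ open F.1, forall U, F.2 U -> open U, forall U, F.2 U -> F.1 `<=` U &
      forall U V, F.2 U -> F.2 V -> U <> V -> U `&` V `<=` F.1].

Definition cells (F : set_family) : set (set X) := [set U `\` F.1 | U in F.2].

(** Two distinct intersections of a member of [F] with a member of [G] differ in one factor, so they
    meet inside the root of that family, within a member of the other one. Adding this set to every
    intersection makes it a common root. *)
Definition meet_root (F G : set_family) : set X :=
  (F.1 `&` \bigcup_(V in G.2) V) `|` ((\bigcup_(U in F.2) U) `&` G.1).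

Definition meet_family (F G : set_family) : set_family :=
  (meet_root F G, [set (U `&` V) `|` meet_root F G | U in F.2 & V in G.2]).

Lemma almost_disjoint_meet F G : almost_disjoint F -> almost_disjoint G ->
  almost_disjoint (meet_family F G).
Proof.
move=> [oF oFU FU Fd] [oG oGV GV Gd].
have oT : open (meet_root F G).
  apply: openU; apply: openI => //; exact: bigcup_open.
split=> //=.
- move=> _ [U FU' [V GV' <-]]; apply: openU => //; apply: openI.
    exact: oFU.
  exact: oGV.
- by move=> _ [U FU' [V GV' <-]] x; right.
- move=> _ _ [U FU1 [V GV1 <-]] [U' FU2 [V' GV2 <-]] ne x.
  move=> [[[Ux Vx]|Tx] U'V'x]; last exact: Tx.
  case: U'V'x => [[U'x V'x]|Tx]; last exact: Tx.
  have [UU'|UU'] := pselect (U = U'); last first.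
    by left; split; [exact: (Fd U U')|exists V].
  have [VV'|VV'] := pselect (V = V'); last first.
    by right; split; [exists U|exact: (Gd V V')].
  by exfalso; apply: ne; rewrite UU' VV'.
Qed.

(** A point common to [U] and [V] lies in [meet_root F G] exactly when it lies in [F.1] or in
    [G.1]. *)
Lemma cells_meet F G : almost_disjoint F -> almost_disjoint G ->
  cells (meet_family F G) = [set C `&` D | C in cells F & D in cells G].
Proof.
move=> [oF oFU FU Fd] [oG oGV GV Gd].
have E U V : F.2 U -> G.2 V ->
    ((U `&` V) `|` meet_root F G) `\` meet_root F G =
    (U `\` F.1) `&` (V `\` G.1).
  move=> FU' GV'; apply/seteqP; split=> x /=.
    move=> [[[Ux Vx]|//] nT]; split; split=> // h; apply: nT.
      by left; split=> //; exists V.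
    by right; split=> //; exists U.
  by move=> [[Ux nF] [Vx nG]]; split; [left|case=> [[]|[]]].
apply/seteqP; split=> C.
  move=> [_ [U FU' [V GV' <-]] <-]; exists (U `\` F.1); first by exists U.
  by exists (V `\` G.1); [exists V|rewrite E].
move=> [_ [U FU' <-] [_ [V GV' <-] <-]].
exists ((U `&` V) `|` meet_root F G); last by rewrite /= E.
by exists U => //; exists V.
Qed.

Context (B : Type) (F : B -> set_family).
Hypothesis adF : forall b, almost_disjoint (F b).

(** The initial family has the whole space as its only cell, so it is neutral for the intersection
    of cells. *)
Definition meet_families (s : seq B) : set_family :=
  foldr (fun b => meet_family (F b)) (set0, [set setT]) s.

Lemma almost_disjoint_families s : almost_disjoint (meet_families s).
Proof.
elim: s => [|b s ih]; last exact: almost_disjoint_meet.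
split=> /=; [exact: open0|by move=> _ ->; exact: openT|by move=> W _ x|].
by move=> _ _ -> ->.
Qed.

Definition all_cells : set (set X) := \bigcup_s cells (meet_families s).

Lemma cells_nil : cells (meet_families [::]) = [set setT].
Proof.
apply/seteqP; split=> C.
  by move=> [_ /= -> <-]; rewrite setD0.
by move=> /= ->; exists setT => //; rewrite setD0.
Qed.

Lemma cells_cons b s : cells (meet_families (b :: s)) =
  [set C `&` D | C in cells (F b) & D in cells (meet_families s)].
Proof. by rewrite [LHS]cells_meet//; exact: almost_disjoint_families. Qed.

Lemma all_cellsT : all_cells setT.
Proof. by exists [::] => //; rewrite cells_nil. Qed.

Lemma cells_sub b : cells (F b) `<=` all_cells.
Proof.
move=> C FC; exists [:: b] => //; rewrite cells_cons cells_nil.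
by exists C => //; exists setT => //; rewrite setIT.
Qed.

(** Cells of two lists intersect in a cell of the concatenated list. The cells thus form a
    pi-system. *)
Lemma all_cellsI : setI_closed all_cells.
Proof.
move=> C D [s _ Cs] [t _ Dt]; exists (s ++ t) => //.
elim: s C Cs => [|b s ih] C; first by rewrite cells_nil => ->; rewrite setTI.
rewrite cells_cons => -[C1 bC1 [C2 sC2 <-]]; rewrite cat_cons cells_cons.
by exists C1 => //; exists (C2 `&` D); [exact: ih|rewrite setIA].
Qed.

End set_families.

(** The empty list gives the whole space; at level 0, the cell of [gruenhage_family] is then the set
    of points outside all members. *)
Definition meet_seq (T : Type) (s : seq (set T)) : set T :=
  [set x | forall V, V \in s -> V x].

Lemma meet_seq_nil (T : Type) : meet_seq [::] = [set: T].
Proof. by apply/seteqP; split. Qed.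

Lemma meet_seq_cons (T : Type) (V : set T) s :
  meet_seq (V :: s) = V `&` meet_seq s.
Proof.
apply/seteqP; split=> x.
  move=> h; split; first by apply: h; rewrite mem_head.
  by move=> W Ws; apply: h; rewrite inE Ws orbT.
by move=> [Vx sx] W; rewrite inE => /predU1P[->//|]; exact: sx.
Qed.

(** * Countably many almost disjoint families in a Gruenhage space *)

Section gruenhage_families.
Context (X : topologicalType) (U : nat -> set (set X)).
Hypothesis oU : forall n V, U n V -> open V.

Lemma open_meet_seq (s : seq (set X)) :
  (forall V, V \in s -> open V) -> open (meet_seq s).
Proof.
elim: s => [|V s ih] os; first by rewrite meet_seq_nil; exact: openT.
rewrite meet_seq_cons; apply: openI; first by apply: os; rewrite mem_head.
by apply: ih => W Ws; apply: os; rewrite inE Ws orbT.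
Qed.

Definition subfamilies n k : set (seq (set X)) :=
  [set s | [/\ uniq s, size s = k & forall V, V \in s -> U n V]].

(** A point is outside exactly when it lies in at most [k] members of [U n]; hence the [k.+1]. *)
Definition overlap n k : set X := \bigcup_(s in subfamilies n k.+1) meet_seq s.

Lemma open_overlap n k : open (overlap n k).
Proof.
apply: bigcup_open => s [_ _ sU]; apply: open_meet_seq => V /sU; exact: oU.
Qed.

(* A point outside [overlap n k] that belongs to [k] members of [U n] lies in
   exactly one of the sets [meet_seq s], [s] in [subfamilies n k]. *)
Definition gruenhage_family (i : nat * nat * bool) : set_family X :=
  let R := overlap i.1.1 i.1.2 in
  if i.2 then (R, [set meet_seq s `|` R | s in subfamilies i.1.1 i.1.2])
  else (set0, [set R]).

(** If the meets of two lists of [k] members share a point outside the root, the lists have the same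
    elements, since a further element would put the point in [k.+1] members. *)
Lemma almost_disjoint_gruenhage i : almost_disjoint (gruenhage_family i).
Proof.
case: i => [[n k] []]; rewrite /gruenhage_family/=; last first.
  by split=> [|V ->|V _ x|V W -> ->]//=; [exact: open0|exact: open_overlap].
split=> /=; first exact: open_overlap.
- move=> _ [s [_ _ sU] <-]; apply: openU; last exact: open_overlap.
  by apply: open_meet_seq => V /sU; exact: oU.
- by move=> _ [s _ <-] x; right.
move=> _ _ [s [us sk sU] <-] [t [ut tk tU] <-] ne x [[sx|//] [tx|//]].
apply: contrapT => nx; apply: ne; congr (_ `|` _).
suff st : s =i t.
  by apply/seteqP; split=> y h V; [rewrite -st|rewrite st]; exact: h.
have sub : {subset t <= s}.
  move=> V Vt; apply: contrapT => /negP Vs; apply: nx; exists (V :: s).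
    split=> [||W]; rewrite /= ?Vs ?sk//.
    by rewrite inE => /predU1P[->|/sU//]; exact: tU.
  by move=> W; rewrite inE => /predU1P[->|/sx//]; exact: tx.
by move=> V; have [] := uniq_min_size ut sub _; rewrite ?sk ?tk.
Qed.

(** Let [k] be the number of members that contain [x]. Then [x] lies in the cell of the list [s] of
    these members. If [y] were in this cell too, then either [V] would belong to [s] and miss [y],
    or it would be a further member around [y] and put [y] in the overlap. *)
Let separates_finite n V x y : U n V -> (V x /\ ~ V y \/ ~ V x /\ V y) ->
  finite_set [set W | U n W /\ W x] ->
  exists i C, cells (gruenhage_family i) C /\ (C x /\ ~ C y \/ ~ C x /\ C y).
Proof.
move=> UV Vxy /finite_seqP[s' s'E].
pose s := undup s'; pose k := size s.
have sP W : W \in s <-> U n W /\ W x.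
  rewrite mem_undup; have : [set` s'] W <-> (U n W /\ W x) by rewrite -s'E.
  by [].
have sx : meet_seq s x by move=> W /sP[].
have sU : subfamilies n k s by split=> //; [exact: undup_uniq|move=> W /sP[]].
have nx : ~ overlap n k x.
  move=> [t [ut tk tU] tx]; have : (size t <= size s)%N.
    by apply: uniq_leq_size => // W Wt; apply/sP; split; [exact: tU|exact: tx].
  by rewrite tk ltnn.
(* A [y] in more than [k] members is separated by the only cell of the family with flag [false], the
   overlap itself. *)
have [oy|oy] := pselect (overlap n k y).
  exists (n, k, false), (overlap n k); split; last by right.
  by exists (overlap n k) => //=; rewrite setD0.
exists (n, k, true), ((meet_seq s `|` overlap n k) `\` overlap n k); split.
  by exists (meet_seq s `|` overlap n k) => //; exists s.
left; split; first by split=> //; left.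
move=> [[sy|//] _]; case: Vxy => [[Vx Vy]|[Vx Vy]].
  by apply: Vy; apply: sy; apply/sP.
apply: oy; exists (V :: s).
  split=> /= [||W]; rewrite ?undup_uniq ?andbT//.
    by apply/negP => /sP[].
  by rewrite inE => /predU1P[->//|/sP[]].
by move=> W; rewrite inE => /predU1P[->|/sy].
Qed.

Lemma gruenhage_family_separates x y :
  (exists n V, [/\ U n V, exists z, V `&` [set x; y] = [set z] &
        finite_set [set W | U n W /\ W x] \/
        finite_set [set W | U n W /\ W y]]) -> x <> y ->
  exists i C, cells (gruenhage_family i) C /\ (C x /\ ~ C y \/ ~ C x /\ C y).
Proof.
move=> [n [V [UV [z /seteqP[Vz zV] fin]]]] xy.
have V1 : V x /\ ~ V y \/ ~ V x /\ V y.
  have [Vx|Vx] := pselect (V x); have [Vy|Vy] := pselect (V y); first last.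
  - by have [? [E|E]] := zV z erefl; exfalso; [apply: Vx|apply: Vy]; rewrite -E.
  - by right.
  - by left.
  - exfalso; apply: xy; rewrite (Vz x); last by split=> //; left.
    by rewrite (Vz y)//; split=> //; right.
case: fin => fin; first exact: separates_finite UV V1 fin.
have V2 : V y /\ ~ V x \/ ~ V y /\ V x by case: V1 => -[]; [right|left].
have [i [C [iC Cyx]]] := separates_finite UV V2 fin.
by exists i, C; split=> //; case: Cyx => -[]; [right|left].
Qed.

End gruenhage_families.

(** * Regular measures that agree on all cells *)

Section clopen_traces.
Context (X : ptopologicalType) (D : set X) (S : set (set X)).
Hypothesis cD : compact D.
Hypotheses (ST : S setT) (SC : forall B, S B -> S (~` B)).
Hypothesis SI : forall B C, S B -> S C -> S (B `&` C).
Hypothesis Scl : forall B, S B -> closed (B `&` D).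
Hypothesis Ssep : forall x y, D x -> D y -> x <> y ->
  exists B, [/\ S B, B x & ~ B y].

Let S_meet_seq (s : seq (set X)) :
  (forall B, B \in s -> S B) -> S (meet_seq s).
Proof.
elim: s => [|B s ih] sS; first by rewrite meet_seq_nil.
rewrite meet_seq_cons; apply: SI; first by apply: sS; rewrite mem_head.
by apply: ih => C Cs; apply: sS; rewrite inE Cs orbT.
Qed.

(** The usual two-step compactness argument: first a point of [P] is separated from [Q], then [P]
    from [Q]. Since the traces on [D] are clopen, complements of sets in [S] serve as the open sets
    of the covers. *)
Lemma clopen_trace_separation P Q : P `<=` D -> Q `<=` D -> closed P ->
  closed Q -> P `&` Q = set0 ->
  exists B, [/\ S B, P `<=` B & B `&` Q = set0].
Proof.
move=> PD QD clP clQ PQ.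
have cP : compact P by exact: (subclosed_compact clP cD).
have cQ : compact Q by exact: (subclosed_compact clQ cD).
have sep1 x : P x -> exists B, [/\ S B, B x & B `&` Q = set0].
  move=> Px; move: cQ; rewrite compact_cover.
  move=> /(_ _ [set B | S B /\ B x] (fun B => ~` (B `&` D))) [||s sS Qs].
  - by move=> B [SB _]; apply: closed_openC; exact: Scl.
  - move=> y Qy; have [|B [SB Bx nBy]] := Ssep (PD _ Px) (QD _ Qy).
      by move=> xy; rewrite -xy in Qy; have : (P `&` Q) x by []; rewrite PQ.
    by exists B => // -[].
  exists (meet_seq (finmap.enum_fset s)); split.
  - by apply: S_meet_seq => B /sS; rewrite inE => -[].
  - by move=> B /sS; rewrite inE => -[].
  - rewrite -subset0 => y [sy Qy]; have [B /= Bs] := Qs y Qy; apply.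
    by split; [exact: sy|exact: QD].
(* The cover of [P] consists of the sets [B], each enlarged by the complement of [D] to become
   open. *)
move: cP; rewrite compact_cover.
move=> /(_ _ [set B | S B /\ B `&` Q = set0] (fun B => ~` (~` B `&` D))).
move=> [||s sS Ps].
- by move=> B [SB _]; apply: closed_openC; apply: Scl; exact: SC.
- by move=> x Px; have [B [SB Bx BQ]] := sep1 x Px; exists B => // -[].
exists (~` meet_seq [seq ~` B | B <- (finmap.enum_fset s)]); split.
- apply: SC; apply: S_meet_seq => _ /mapP[B /sS + ->]; rewrite inE => -[SB _].
  exact: SC.
- move=> x Px; have [B /= Bs nBx] := Ps x Px => /(_ (~` B)) nB; apply: nBx.
  by split; [apply: nB; exact: map_f|exact: PD].
- rewrite -subset0 => y [ny Qy]; apply: ny => _ /mapP[B /sS + ->].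
  by rewrite inE => -[_ BQ] By; have : (B `&` Q) y by []; rewrite BQ.
Qed.

End clopen_traces.

(** * Regular Borel measures and clopen traces of the cells *)

Section regular_measures.
Context (R : realType) (K : ptopologicalType).
Hypothesis cK : compact [set: K].
Local Notation borel := (g_sigma_algebraType (@open K)).
Local Open Scope ereal_scope.

Lemma open_borel (A : set K) : open A -> measurable (A : set borel).
Proof. exact: sub_sigma_algebra. Qed.

Lemma closed_borel (A : set K) : closed A -> measurable (A : set borel).
Proof.
move=> cA; rewrite -(setCK A); apply: measurableC; apply: open_borel.
exact: closed_openC.
Qed.

Definition regular_measure (m : set borel -> \bar R) :=
  forall A : set borel, measurable A -> forall e : R, (0 < e)%R ->
  exists C V : set K, [/\ closed C, open V, C `<=` A, A `<=` V &
    m (V `\` C) < e%:E].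

Lemma regular_measureD (m1 m2 : {measure set borel -> \bar R}) :
  regular_measure m1 -> regular_measure m2 ->
  regular_measure (measure_add m1 m2).
Proof.
move=> r1 r2 A mA e e0.
have e20 : (0 < e / 2)%R by rewrite divr_gt0.
have [C1 [V1 [cC1 oV1 CA1 AV1 h1]]] := r1 A mA _ e20.
have [C2 [V2 [cC2 oV2 CA2 AV2 h2]]] := r2 A mA _ e20.
exists (C1 `|` C2), (V1 `&` V2); split.
- exact: closedU.
- exact: openI.
- by move=> x [/CA1|/CA2].
- by move=> x Ax; split; [exact: AV1|exact: AV2].
have mD (C V : set K) : closed C -> open V -> measurable (V `\` C : set borel).
  by move=> cC oV; apply: measurableD; [exact: open_borel|exact: closed_borel].
rewrite measure_addE [e]splitr EFinD lteD//.
  apply: le_lt_trans h1; apply: le_measure; rewrite ?inE; try exact: mD.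
  - by apply: mD; [exact: closedU|exact: openI].
  - by move=> x [[? ?] /not_orP[? ?]].
apply: le_lt_trans h2; apply: le_measure; rewrite ?inE; try exact: mD.
- by apply: mD; [exact: closedU|exact: openI].
- by move=> x [[? ?] /not_orP[? ?]].
Qed.

Context (B : countType) (F : B -> set_family K).
Hypothesis adF : forall b, almost_disjoint (F b).
Hypothesis sepF : forall x y, x <> y ->
  exists b C, cells (F b) C /\ (C x /\ ~ C y \/ ~ C x /\ C y).

(* By compactness, finitely many members of the family cover a closed subset of
   [\bigcup_(U in F.2) U `\` F.1] of almost full measure; the traces of the
   cells on this subset are clopen, as only finitely many are nonempty. *)
Lemma family_clopen_trace (m : {measure set borel -> \bar R})
    (G : set_family K) (e : R) : regular_measure m ->
  almost_disjoint G -> (0 < e)%R ->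
  exists D : set K, [/\ closed D, m (~` D) <= e%:E &
    forall C, cells G C -> closed (C `&` D) /\ closed (D `\` C)].
Proof.
move=> rm [oR oU RU dU] e0; have e20 : (0 < e / 2)%R by rewrite divr_gt0.
pose W := \bigcup_(U in G.2) U.
have oW : open W by exact: bigcup_open.
have mR : measurable (G.1 : set borel) by exact: open_borel.
have mW : measurable (W : set borel) by exact: open_borel.
have [C1 [V1 [cC1 oV1 CA1 AV1 h1]]] := rm _ (measurableD mW mR) _ e20.
have [C2 [V2 [cC2 oV2 CA2 AV2 h2]]] := rm _ mR _ e20.
have [s sG Cs] : finite_subset_cover G.2 id C1.
  have : compact C1 by exact: (subclosed_compact cC1 cK).
  rewrite compact_cover; apply => //.
  by move=> x /CA1[[U GU Ux] _]; exists U.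
(* Three closed pieces: inner approximations of the union of the cells and of the root, and the
   complement of all members. *)
exists (C1 `|` C2 `|` ~` W); split.
- by apply: closedU; [exact: closedU|exact: open_closedC].
- have mCV (C V : set K) : closed C -> open V ->
      measurable (V `\` C : set borel).
    move=> cC oV; apply: measurableD; first exact: open_borel.
    exact: closed_borel.
  rewrite (@le_trans _ _ (m ((V1 `\` C1) `|` (V2 `\` C2))))//.
    apply: le_measure; rewrite ?inE.
    - apply: measurableC; apply: closed_borel.
      by apply: closedU; [exact: closedU|exact: open_closedC].
    - by apply: measurableU; exact: mCV.
    - move=> x /= nx; have Wx : W x by apply: contrapT => h; apply: nx; right.
      have [Rx|Rx] := pselect (G.1 x).
        by right; split; [exact: AV2|move=> h; apply: nx; left; right].
      by left; split; [exact: AV1|move=> h; apply: nx; left; left].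
  apply: le_trans (measureU2 m (mCV _ _ cC1 oV1) (mCV _ _ cC2 oV2)) _.
  by rewrite [e]splitr EFinD leeD// ltW.
move=> _ [U GU <-].
have clU : closed (C1 `&` U).
  (* Inside [C1], which avoids the root, the other members of the finite cover miss [U]; removing
     their union, an open set, leaves the trace of [U]. *)
  pose O := \bigcup_(V in [set V | V \in finmap.enum_fset s /\ V <> U]) V.
  rewrite (_ : _ `&` _ = C1 `&` ~` O); last first.
    apply/seteqP; split=> x [C1x].
      move=> Ux; split=> // -[V [Vs VU] Vx]; case: (CA1 _ C1x) => _; apply.
      by apply: (dU V U) => //; move: (sG _ Vs); rewrite inE.
    move=> nO; split=> //; have [V /= Vs Vx] := Cs x C1x.
    have [<-//|VU] := pselect (V = U).
    by exfalso; apply: nO; exists V.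
  apply: closedI => //; apply: open_closedC; apply: bigcup_open => V [Vs _].
  by apply: oU; move: (sG _ Vs); rewrite inE.
split.
  rewrite (_ : _ `&` _ = C1 `&` U)//; apply/seteqP; split=> x.
    move=> [[Ux nRx] [[//|/CA2//]|nW]]; exfalso; apply: nW.
    by exists U.
  by move=> [C1x Ux]; split; [split=> //; case: (CA1 _ C1x)|left; left].
rewrite (_ : _ `\` _ = C2 `|` ~` W `|` (C1 `\` U)).
  apply: closedU; first by apply: closedU => //; exact: open_closedC.
  by apply: closedI => //; apply: open_closedC; exact: oU.
apply/seteqP; split=> x.
  move=> [[[C1x|C2x]|Wx] nx]; [right|left; left|left; right] => //.
  by split=> // Ux; apply: nx; split=> //; case: (CA1 _ C1x).
move=> [[C2x|Wx]|[C1x nUx]]; split.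
- by left; right.
- by move=> [_]; apply; exact: CA2.
- by right.
- by move=> [Ux _]; apply: Wx; exists U.
- by left; left.
- by case.
Qed.

(** The sets for the single families are intersected, the one with code [k] losing at most
    [e / 2 ^ k.+1]; a code of no family gets the whole space. *)
Lemma families_clopen_trace (m : {measure set borel -> \bar R}) (e : R) :
  regular_measure m -> (0 < e)%R ->
  exists D : set K, [/\ closed D, m (~` D) <= e%:E &
    forall b C, cells (F b) C -> closed (C `&` D) /\ closed (D `\` C)].
Proof.
move=> rm e0.
have /choice[D DP] : forall k, exists D : set K, [/\ closed D,
    m (~` D) <= (e / (2 ^ k.+1)%:R)%:E & forall b, unpickle k = Some b ->
    forall C, cells (F b) C -> closed (C `&` D) /\ closed (D `\` C)].
  move=> k; have ek : (0 < e / (2 ^ k.+1)%:R)%R.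
    by rewrite divr_gt0// ltr0n expn_gt0.
  case E : (unpickle k) => [b|]; last first.
    exists setT; split=> //.
    by rewrite setCT measure0 lee_fin ltW.
  have [D [cD mD DF]] := family_clopen_trace rm (adF b) ek.
  by exists D; split=> // _ [<-].
exists (\bigcap_k D k); split.
- by apply: closed_bigI => k _; have [] := DP k.
- rewrite setC_bigcap; apply: le_trans (epsilon_trick0 xpredT (ltW e0)).
  apply: le_trans (measure_sigma_subadditive m (F := fun k => ~` D k) _ _ _) _.
  + by move=> k; apply: measurableC; apply: closed_borel; have [] := DP k.
  + apply: bigcupT_measurable => k.
    by apply: measurableC; apply: closed_borel; have [] := DP k.
  + by [].
  + by apply: lee_nneseries => // k _; have [] := DP k.
move=> b C FC; have [cD _ /(_ b (pickleK b) C FC)[c1 c2]] := DP (pickle b).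
have cI : closed (\bigcap_k D k) by apply: closed_bigI => k _; have [] := DP k.
split.
  rewrite (_ : _ `&` _ = (C `&` D (pickle b)) `&` \bigcap_k D k).
    exact: closedI.
  apply/seteqP; split=> x; first by move=> [Cx Dx]; do 2 split=> //; exact: Dx.
  by move=> [[]].
rewrite (_ : _ `\` _ = (D (pickle b) `\` C) `&` \bigcap_k D k).
  exact: closedI.
apply/seteqP; split=> x; first by move=> [Dx Cx]; do 2 split=> //; exact: Dx.
by move=> [[]].
Qed.

Lemma all_cells_borel : all_cells F `<=` @measurable _ borel.
Proof.
move=> C [s _]; have [oR oU _ _] := almost_disjoint_families adF s.
move=> [U FU <-]; apply: measurableD; apply: open_borel => //; exact: oU.
Qed.

(** The cells form a pi-system, so the measures agree on the sigma-algebra [M] that they generate. A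
    Borel set [A] need not belong to [M], but some [Q] in [M] approximates it: with [C] closed
    inside [A], [V] open around [A] and a large closed [D] on which the cells are clopen, [Q]
    separates [C] from the complement of [V] within [D]. *)
Lemma cells_measure_unique (m1 m2 : {measure set borel -> \bar R}) :
  m1 setT < +oo -> regular_measure m1 -> regular_measure m2 ->
  (forall C, all_cells F C -> m1 C = m2 C) ->
  forall A, measurable A -> m1 A = m2 A.
Proof.
move=> m1oo r1 r2 m12.
pose M := g_sigma_algebraType (all_cells F).
have m12s C : @measurable _ M C -> m1 C = m2 C.
  move=> mC.
  apply: (@g_sigma_algebra_measure_unique _ R borel _ all_cells_borel
    (fun=> setT) _ _ m1 m2 _ _ _ C mC) => //.
  - by move=> _; exact: all_cellsT.
  - by apply/seteqP; split=> // x _; exists 0%N.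
  - exact: all_cellsI.
have Mb C : @measurable _ M C -> @measurable _ borel C.
  apply: smallest_sub; first exact: sigma_algebra_measurable.
  exact: all_cells_borel.
suff le (n1 n2 : {measure set borel -> \bar R}) :
    regular_measure n1 -> regular_measure n2 ->
    (forall C, @measurable _ M C -> n1 C = n2 C) ->
    forall A, measurable A -> n1 A <= n2 A.
  move=> A mA; apply/eqP; rewrite eq_le le//= le// => C mC.
  by rewrite m12s.
move=> {m1oo r1 r2 m12 m12s} r1 r2 n12 A mA; apply/lee_addgt0Pr => e e0.
(* Both comparisons of [A] with [Q] cost the measures of [V] minus [C] and of the complement of [D],
   so four errors occur. *)
have e40 : (0 < e / 4)%R by rewrite divr_gt0.
(* Approximations for the sum of the two measures are valid for each of them. *)
have rn := regular_measureD r1 r2.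
have [D [cD nD DF]] := families_clopen_trace rn e40.
have [C [V [cC oV CA AV nVC]]] := rn A mA _ e40.
pose S : set (set K) := [set Q | [/\ @measurable _ M Q, closed (Q `&` D) &
  closed (D `\` Q)]].
have cDD : compact D by exact: (subclosed_compact cD cK).
have [Q [[mQ _ _] CQ QV]] : exists Q, [/\ S Q, C `&` D `<=` Q &
    Q `&` (D `\` V) = set0].
  apply: (clopen_trace_separation cDD).
  - split; [exact: measurableT|by rewrite setTI|rewrite setDT; exact: closed0].
  - move=> Q [mQ c1 c2]; split; first exact: measurableC.
      by rewrite setIC -setDE.
    by rewrite setDE setCK setIC.
  - move=> P Q [mP c1 c2] [mQ c3 c4]; split; first exact: measurableI.
      by rewrite setIIl; exact: closedI.
    by rewrite setDIr; exact: closedU.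
  - by move=> Q [].
  - move=> x y Dx Dy xy; have [b [Q [FQ Qxy]]] := sepF xy.
    have [c1 c2] := DF b Q FQ.
    have mQ : @measurable _ M Q.
      by apply: sub_sigma_algebra; exact: (cells_sub adF FQ).
    case: Qxy => -[Qx Qy]; first by exists Q.
    exists (~` Q); split=> //.
    split; first exact: measurableC.
      by rewrite setIC -setDE.
    by rewrite setDE setCK setIC.
  - by move=> x [].
  - by move=> x [].
  - exact: closedI.
  - by apply: closedI => //; exact: open_closedC.
  - by rewrite -subset0 => x [[Cx _] [_ nVx]]; apply: nVx; apply: AV; exact: CA.
have mVC : measurable (V `\` C : set borel).
  by apply: measurableD; [exact: open_borel|exact: closed_borel].
have mDc : measurable (~` D : set borel).
  by apply: measurableC; exact: closed_borel.
have bound (n : {measure set borel -> \bar R}) (X Y : set borel) :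
    measurable X -> measurable Y ->
    (forall Z, n Z <= measure_add n1 n2 Z) ->
    X `<=` Y `|` ((V `\` C) `|` ~` D) -> n X <= n Y + (e / 2)%:E.
  move=> mX mY nle XY; have mE := measurableU _ _ mVC mDc.
  apply: le_trans (le_measure n _ _ XY) _; rewrite ?inE//.
    exact: measurableU.
  apply: le_trans (measureU2 n mY mE) _; rewrite leeD2l//.
  apply: le_trans (measureU2 n mVC mDc) _.
  rewrite (_ : e / 2 = e / 4 + e / 4)%R; last by field.
  rewrite EFinD leeD//; first by apply: le_trans (nle _) _; exact: ltW.
  exact: le_trans (nle _) _.
have AQ : A `<=` Q `|` ((V `\` C) `|` ~` D).
  move=> x Ax; have [Dx|Dx] := pselect (D x); last by right; right.
  have [Cx|Cx] := pselect (C x); first by left; apply: CQ.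
  by right; left; split=> //; exact: AV.
have QA : Q `<=` A `|` ((V `\` C) `|` ~` D).
  move=> x Qx; have [Dx|Dx] := pselect (D x); last by right; right.
  have [Vx|Vx] := pselect (V x); last first.
    by have : (Q `&` (D `\` V)) x by []; rewrite QV.
  have [Cx|Cx] := pselect (C x); first by left; exact: CA.
  by right; left.
have le1 Z : n1 Z <= measure_add n1 n2 Z by rewrite measure_addE leeDl.
have le2 Z : n2 Z <= measure_add n1 n2 Z by rewrite measure_addE leeDr.
apply: le_trans (bound n1 A Q mA (Mb _ mQ) le1 AQ) _.
rewrite n12// [e in leRHS]splitr EFinD addeA leeD2r//.
exact: (bound n2 Q A (Mb _ mQ) mA le2 QA).
Qed.

End regular_measures.

(** * Positive parts of regular signed measures and the duality with C(K) *)

Section finite_measure_integrals.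
Context d (T : measurableType d) (R : realType).
Implicit Types m : {finite_measure set T -> \bar R}.

Let measure_add_fin m1 m2 : fin_num_fun (measure_add m1 m2).
Proof.
by move=> A mA; rewrite measure_addE fin_numD !fin_num_measure.
Qed.

HB.instance Definition _ m1 m2 := Measure.on (measure_add m1 m2).
HB.instance Definition _ m1 m2 := @Measure_isFinite.Build _ _ _
  (measure_add m1 m2) (measure_add_fin m1 m2).

Let mscale_fin (c : {nonneg R}) m : fin_num_fun (mscale c m).
Proof. by move=> A mA; rewrite /mscale fin_numM// fin_num_measure. Qed.

HB.instance Definition _ c m := @Measure_isFinite.Build _ _ _
  (mscale c m) (mscale_fin c m).

Lemma Rintegral_measure_add m1 m2 (f : T -> R) :
  m1.-integrable setT (EFin \o f) -> m2.-integrable setT (EFin \o f) ->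
  \int[measure_add m1 m2]_x f x = \int[m1]_x f x + \int[m2]_x f x.
Proof.
move=> i1 i2; rewrite /Rintegral (integral_measure_add measurableT i1 i2).
exact: (fineD (integrable_fin_num measurableT i1)
  (integrable_fin_num measurableT i2)).
Qed.

Lemma Rintegral_mscale m (c : {nonneg R}) (f : T -> R) :
  m.-integrable setT (EFin \o f) ->
  \int[mscale c m]_x f x = c%:num * \int[m]_x f x.
Proof.
move=> fi; have ip := integrable_funepos measurableT fi.
have im := integrable_funeneg measurableT fi.
have pfin := integrable_fin_num measurableT ip.
have nfin := integrable_fin_num measurableT im.
rewrite /Rintegral integralE [in RHS]integralE.
rewrite ge0_integral_mscale//; last exact: measurable_int ip.
rewrite ge0_integral_mscale//; last exact: measurable_int im.
by rewrite -(fineK pfin) -(fineK nfin) -!EFinM -!EFinB/= mulrBr.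
Qed.

End finite_measure_integrals.

(** * Positive and negative parts of a signed measure *)

Section jordan_parts.
Context (R : realType) (K : ptopologicalType).
Local Notation borel := (g_sigma_algebraType (@open K)).
Implicit Types mu nu : rsm R K.

Definition rsm_pos mu := jordan_pos (hahn_posneg (rsm_charge mu)).
Definition rsm_neg mu := jordan_neg (hahn_posneg (rsm_charge mu)).

HB.instance Definition _ mu := FiniteMeasure.on (rsm_pos mu).
HB.instance Definition _ mu := FiniteMeasure.on (rsm_neg mu).

Definition rpos mu (A : set borel) : R := fine (rsm_pos mu A).

Lemma rposE mu (A : set borel) : measurable A -> rsm_pos mu A = (rpos mu A)%:E.
Proof. by move=> mA; rewrite /rpos fineK// fin_num_measure. Qed.

Lemma rpos_ge0 mu (A : set borel) : 0 <= rpos mu A.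
Proof. by rewrite fine_ge0. Qed.

Lemma rpos_hahn mu (A : set borel) : measurable A ->
  rpos mu A = mu (A `&` hahn_pos (rsm_charge mu)).
Proof.
by move=> mA; rewrite /rpos /rsm_pos jordan_posE cjordan_posE /crestr0 mem_set.
Qed.

Lemma rsm_neg_hahn mu (A : set borel) : measurable A ->
  rsm_neg mu A = (- mu (A `&` hahn_neg (rsm_charge mu)))%:E.
Proof.
move=> mA; rewrite /rsm_neg jordan_negE cjordan_negE /crestr0 mem_set//.
Qed.

Lemma rsm_sub mu (A : set borel) : measurable A ->
  (mu A)%:E = (rsm_pos mu A - rsm_neg mu A)%E.
Proof.
move=> mA; rewrite -[LHS]/(rsm_charge mu A).
by rewrite (jordan_decomp (hahn_posneg (rsm_charge mu)) mA) /cadd/= cscaleN1.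
Qed.

(** With [rpos_hahn], this makes [rpos mu A] the maximum of [mu] over the Borel subsets of [A];
    subadditivity and homogeneity follow although each measure has its own Hahn decomposition. *)
Lemma rpos_ge mu (A B : set borel) : measurable A -> measurable B -> B `<=` A ->
  mu B <= rpos mu A.
Proof.
move=> mA mB BA; rewrite -lee_fin rsm_sub// -rposE//.
apply: (@le_trans _ _ (rsm_pos mu B)); last by apply: le_measure; rewrite ?inE.
by rewrite leeBlDr ?fin_num_measure// leeDl.
Qed.

Lemma rsmD mu nu (A : set K) : (mu + nu) A = mu A + nu A.
Proof. by []. Qed.

Lemma rsmZ a mu (A : set K) : (a *: mu) A = a * mu A.
Proof. by []. Qed.

Lemma rsmN mu (A : set K) : (- mu) A = - mu A.
Proof. by []. Qed.

Lemma measurable_hahn_pos mu :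
  measurable (hahn_pos (rsm_charge mu) : set borel).
Proof. by have [[]] := hahn_posneg (rsm_charge mu). Qed.

Lemma measurable_hahn_neg mu :
  measurable (hahn_neg (rsm_charge mu) : set borel).
Proof. by have [_ []] := hahn_posneg (rsm_charge mu). Qed.

Let mAP mu (A : set borel) : measurable A ->
  measurable (A `&` hahn_pos (rsm_charge mu)).
Proof. by move=> mA; apply: measurableI => //; exact: measurable_hahn_pos. Qed.

(** The Hahn decompositions of [mu] and [- mu] are chosen separately, so equality comes from two
    maximality arguments. *)
Lemma rpos_opp mu (A : set borel) : measurable A ->
  rsm_neg mu A = (rpos (- mu) A)%:E.
Proof.
move=> mA; apply/eqP; rewrite eq_le; apply/andP; split.
  rewrite rsm_neg_hahn// lee_fin -rsmN; apply: rpos_ge => //.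
  by apply: measurableI => //; exact: measurable_hahn_neg.
rewrite rpos_hahn// rsmN; set B := _ `&` _.
have mB : measurable B by exact: mAP.
rewrite EFinN rsm_sub// fin_num_oppeB ?fin_num_measure//.
rewrite (@le_trans _ _ (rsm_neg mu B))//.
  by rewrite addeC leeBlDr ?fin_num_measure// leeDl.
by apply: le_measure; rewrite ?inE//; exact: subIsetl.
Qed.

Lemma rposD mu nu (A : set borel) : measurable A ->
  rpos (mu + nu) A <= rpos mu A + rpos nu A.
Proof.
move=> mA; rewrite [leLHS]rpos_hahn// rsmD.
by apply: lerD; apply: rpos_ge => //; exact: mAP.
Qed.

Lemma rposZ c mu (A : set borel) : measurable A -> 0 <= c ->
  rpos (c *: mu) A = c * rpos mu A.
Proof.
move=> mA c0; apply/eqP; rewrite eq_le; apply/andP; split.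
  rewrite rpos_hahn// rsmZ ler_wpM2l//; apply: rpos_ge => //; exact: mAP.
by rewrite [rpos mu A]rpos_hahn// -rsmZ; apply: rpos_ge => //; exact: mAP.
Qed.

Lemma rsm_rpos mu (A : set borel) : measurable A ->
  mu A = rpos mu A - rpos (- mu) A.
Proof.
by move=> mA; apply: EFin_inj; rewrite rsm_sub// rposE// rpos_opp// EFinB.
Qed.

Lemma variation_rpos mu (A : set borel) : measurable A ->
  Defs.variation mu A = (rpos mu A + rpos (- mu) A)%:E.
Proof. by move=> mA; rewrite EFinD -rposE// -rpos_opp. Qed.

Lemma rsm_normE mu : (`|mu| : R) = rpos mu setT + rpos (- mu) setT.
Proof.
rewrite -[LHS]/(variation_norm mu) /variation_norm.
by rewrite variation_rpos//; exact: measurableT.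
Qed.

Lemma rpos_le mu (A B : set borel) : measurable A -> measurable B -> A `<=` B ->
  rpos mu A <= rpos mu B.
Proof.
move=> mA mB AB; rewrite -lee_fin -!rposE//.
by apply: le_measure; rewrite ?inE.
Qed.

Lemma rposU2 mu (A B : set borel) : measurable A -> measurable B ->
  rpos mu (A `|` B) <= rpos mu A + rpos mu B.
Proof.
move=> mA mB; rewrite -lee_fin EFinD -!rposE//; first exact: measureU2.
exact: measurableU.
Qed.

Lemma rposU mu (A B : set borel) : measurable A -> measurable B ->
  A `&` B = set0 -> rpos mu (A `|` B) = rpos mu A + rpos mu B.
Proof.
move=> mA mB AB; apply: EFin_inj; rewrite EFinD -!rposE//; last first.
  exact: measurableU.
exact: measureU.
Qed.

Lemma rpos_setD mu (A B : set borel) : measurable A -> measurable B ->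
  B `<=` A -> rpos mu (A `\` B) = rpos mu A - rpos mu B.
Proof.
move=> mA mB BA; rewrite -[in RHS](setDUK BA) setUC rposU//.
- by rewrite addrK.
- exact: measurableD.
- by rewrite setDE -setIA setICl setI0.
Qed.

Lemma rsm_setU mu (A B : set borel) : measurable A -> measurable B ->
  A `&` B = set0 -> mu (A `|` B) = mu A + mu B.
Proof.
move=> mA mB AB; rewrite !rsm_rpos//; last exact: measurableU.
by rewrite !rposU//; lra.
Qed.

Lemma rsm_ext mu nu : (forall A : set borel, measurable A -> mu A = nu A) ->
  mu = nu.
Proof.
move=> E; apply/val_inj/funext => A.
have [mA|mA] := pselect (measurable (A : set borel)); first exact: E.
have [_ _ [_ zmu]] := rsmP mu; have [_ _ [_ znu]] := rsmP nu.
by rewrite /= zmu// znu.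
Qed.

Let midpoint_split (p q p' q' u u' : R) :
  u <= 2^-1 * (p + q) -> u' <= 2^-1 * (p' + q') -> p + p' = q + q' ->
  p + p' = u + u' -> 0 <= p' -> 0 <= q' -> u' = 0 -> p = q /\ p' = q'.
Proof.
move=> h h' s s' p'0 q'0 u0; have p'E : p' = 0 by lra.
have q'E : q' = 0 by lra.
by split; lra.
Qed.

(** On the positive set of the midpoint [la], the common variation equals the positive part of [la],
    which is at most the mean of those of [mu] and [nu]. This leaves no room for negative parts of
    [mu] and [nu], so their positive parts agree. On the negative set the roles are exchanged. *)
Lemma variation_midpoint mu nu :
  (forall A : set borel, measurable A ->
    Defs.variation mu A = Defs.variation nu A) ->
  (forall A : set borel, measurable A ->
    Defs.variation mu A = Defs.variation (2^-1 *: (mu + nu)) A) ->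
  mu = nu.
Proof.
move=> vE vzE; set la := 2^-1 *: (mu + nu) in vzE.
have half A : measurable A -> rpos la A <= 2^-1 * (rpos mu A + rpos nu A) /\
    rpos (- la) A <= 2^-1 * (rpos (- mu) A + rpos (- nu) A).
  move=> mA; rewrite /la -scalerN opprD !rposZ// !ler_pM2l//.
  by split; exact: rposD.
have sums A : measurable A ->
    rpos mu A + rpos (- mu) A = rpos nu A + rpos (- nu) A /\
    rpos mu A + rpos (- mu) A = rpos la A + rpos (- la) A.
  move=> mA; split; apply: EFin_inj; rewrite -!variation_rpos//;
    [exact: vE|exact: vzE].
apply: rsm_ext => A mA; have [_ _ PN PN0] := hahn_posneg (rsm_charge la).
have mP := measurable_hahn_pos la; have mN := measurable_hahn_neg la.
set P := hahn_pos _ in PN PN0 mP; set N := hahn_neg _ in PN PN0 mN.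
have mP' := measurableI _ _ mA mP; have mN' := measurableI _ _ mA mN.
have la0 : la set0 = 0 by have := charge0 (rsm_charge la) => -[].
have nP : rpos (- la) (A `&` P) = 0.
  apply: EFin_inj; rewrite -rpos_opp// rsm_neg_hahn//.
  by rewrite -/N -setIA PN0 setI0 la0 oppr0.
have pN : rpos la (A `&` N) = 0.
  by rewrite rpos_hahn// -/P -setIA (setIC N) PN0 setI0 la0.
rewrite -[A]setIT -PN setIUr !rsm_setU//; last 2 first.
- by rewrite setIACA PN0 setI0.
- by rewrite setIACA PN0 setI0.
rewrite !rsm_rpos//.
have [h1 h1'] := half _ mP'; have [h2 h2'] := half _ mN'.
have [s1 s1'] := sums _ mP'; have [s2 s2'] := sums _ mN'.
have [p1 p2] := (rpos_ge0 (- mu) (A `&` P), rpos_ge0 (- nu) (A `&` P)).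
have [p3 p4] := (rpos_ge0 mu (A `&` N), rpos_ge0 nu (A `&` N)).
have : rpos mu (A `&` P) = rpos nu (A `&` P) /\
  rpos (- mu) (A `&` P) = rpos (- nu) (A `&` P).
  exact: midpoint_split h1 h1' s1 s1' p1 p2 nP.
have : rpos mu (A `&` N) = rpos nu (A `&` N) /\
  rpos (- mu) (A `&` N) = rpos (- nu) (A `&` N).
  rewrite addrC [RHS]addrC in s2; rewrite addrC [RHS]addrC in s2'.
  by have [] := midpoint_split h2' h2 s2 s2' p3 p4 pN.
by move=> [-> ->] [-> ->].
Qed.

Lemma rsm_le_norm mu (A : set borel) : measurable A -> `|mu A| <= `|mu|.
Proof.
move=> mA; rewrite rsm_rpos// rsm_normE.
apply: le_trans (ler_normB _ _) _; rewrite !ger0_norm ?rpos_ge0//.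
by apply: lerD; apply: rpos_le => //; exact: measurableT.
Qed.

Lemma regular_variation mu : regular_measure (Defs.variation mu).
Proof.
have [nu rnu [muE _]] := rsmP mu.
have tvE A : measurable A -> Defs.variation mu A = Defs.total_variation nu A.
  by apply: Defs.total_variation_eq => B mB; rewrite -muE.
move=> A mA e e0; have [C [V [cC oV CA AV lt]]] := rnu A mA e e0.
exists C, V; split=> //; rewrite tvE//.
by apply: measurableD; [exact: open_borel|exact: closed_borel].
Qed.

Lemma regular_rsm_pos mu : regular_measure (rsm_pos mu).
Proof.
move=> A mA e e0; have [C [V [cC oV CA AV lt]]] := regular_variation mu mA e0.
exists C, V; split=> //; apply: le_lt_trans lt.
have mVC : measurable (V `\` C : set borel).
  by apply: measurableD; [exact: open_borel|exact: closed_borel].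
by rewrite rposE// variation_rpos// lee_fin lerDl rpos_ge0.
Qed.

End jordan_parts.

(** * The integration pairing between continuous functions and measures *)

Section rsm_duality.
Context (R : realType) (K : ptopologicalType) (cK : compact [set: K]).
Local Notation borel := (g_sigma_algebraType (@open K)).
Implicit Types (mu nu : rsm R K) (f g : cspace R cK).

Lemma cspace_measurable f : measurable_fun [set: borel] (f : borel -> R).
Proof.
have /continuousP cf := @cspace_continuous _ _ _ f.
apply: (measurability _ (RGenOpens.measurableE R)) => _ [_ [a [b ->]] <-].
by rewrite setTI; apply: open_borel; apply: cf; exact: interval_open.
Qed.

Lemma cspace_integrable (m : {finite_measure set borel -> \bar R}) f :
  m.-integrable setT (EFin \o (f : borel -> R)).
Proof.
apply: measurable_bounded_integrable => //.
- by rewrite ltey_eq fin_num_measure.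
- exact: cspace_measurable.
- exists (sup_norm f); split; first exact: num_real.
  by move=> M fM x _ /=; exact: le_trans (le_sup_norm f x) (ltW fM).
Qed.

(* The integral does not depend on the decomposition of [mu] as a difference of
   finite measures, hence it is linear in [mu]. *)
Lemma rsm_integralE mu (m1 m2 : {finite_measure set borel -> \bar R}) f :
  (forall A : set borel, measurable A -> (mu A)%:E = (m1 A - m2 A)%E) ->
  rsm_integral mu f = \int[m1]_x f x - \int[m2]_x f x.
Proof.
move=> muE; rewrite /rsm_integral -/(rsm_pos mu) -/(rsm_neg mu).
(* Rearranged, the two decompositions of [mu] become an equality between sums of positive
   measures. *)
have : \int[measure_add (rsm_pos mu) m2]_x f x =
       \int[measure_add m1 (rsm_neg mu)]_x f x.
  rewrite /Rintegral; congr fine; apply: eq_measure_integral => A mA _.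
  rewrite -[LHS]/(measure_add _ _ A) -[RHS]/(measure_add _ _ A) !measure_addE.
  have swap (w x y z : \bar R) : w \is a fin_num -> x \is a fin_num ->
      y \is a fin_num -> z \is a fin_num ->
      (w - x = y - z -> w + z = y + x)%E.
    move: w x y z => [w||] [x||] [y||] [z||]//= _ _ _ _.
    by rewrite -!EFinB -!EFinD => -[h]; congr EFin; lra.
  apply: swap; try exact: fin_num_measure.
  by rewrite -rsm_sub// muE.
rewrite !Rintegral_measure_add; try exact: cspace_integrable.
by move: (\int[_]_x _) (\int[_]_x _) (\int[_]_x _) (\int[_]_x _) => *; lra.
Qed.

Definition rsm_pair f mu : R := rsm_integral mu f.

Lemma rsm_pairDl f g mu : rsm_pair (f + g) mu = rsm_pair f mu + rsm_pair g mu.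
Proof.
have E (m : {finite_measure set borel -> \bar R}) :
    \int[m]_x (f + g) x = \int[m]_x f x + \int[m]_x g x.
  exact: (RintegralD measurableT (cspace_integrable m f)
    (cspace_integrable m g)).
by rewrite /rsm_pair /rsm_integral !E opprD addrACA.
Qed.

Lemma rsm_pairZl a f mu : rsm_pair (a *: f) mu = a * rsm_pair f mu.
Proof.
have E (m : {finite_measure set borel -> \bar R}) :
    \int[m]_x (a *: f) x = a * \int[m]_x f x.
  exact: (RintegralZl a measurableT (cspace_integrable m f)).
by rewrite /rsm_pair /rsm_integral !E mulrBr.
Qed.

Lemma rsm_pairDr f mu nu : rsm_pair f (mu + nu) = rsm_pair f mu + rsm_pair f nu.
Proof.
rewrite /rsm_pair (rsm_integralE (m1 := measure_add (rsm_pos mu) (rsm_pos nu))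
  (m2 := measure_add (rsm_neg mu) (rsm_neg nu))).
  rewrite !Rintegral_measure_add; try exact: cspace_integrable.
  by rewrite opprD addrACA.
move=> A mA; rewrite rsmD EFinD !rsm_sub//.
rewrite -[X in _ = (X - _)%E]/(measure_add _ _ A).
rewrite -[X in _ = (_ - X)%E]/(measure_add _ _ A) !measure_addE.
by rewrite fin_num_oppeD ?fin_num_measure// addeACA.
Qed.

Lemma rsm_pairZr_ge0 a f mu : 0 <= a ->
  rsm_pair f (a *: mu) = a * rsm_pair f mu.
Proof.
move=> a0; rewrite /rsm_pair.
rewrite (rsm_integralE (m1 := mscale (NngNum a0) (rsm_pos mu))
  (m2 := mscale (NngNum a0) (rsm_neg mu))).
  by rewrite !Rintegral_mscale ?mulrBr//; exact: cspace_integrable.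
move=> A mA; rewrite rsmZ EFinM rsm_sub// /mscale/=.
have dist (x y : \bar R) : x \is a fin_num -> y \is a fin_num ->
    (a%:E * (x - y) = a%:E * x - a%:E * y)%E.
  move: x y => [x||] [y||]//= _ _.
  exact: (congr1 EFin (mulrBr a x y)).
by rewrite dist ?fin_num_measure.
Qed.

Lemma rsm_pairNr f mu : rsm_pair f (- mu) = - rsm_pair f mu.
Proof.
have := rsm_pairDr f mu (- mu); rewrite subrr.
rewrite -(scale0r mu) rsm_pairZr_ge0// mul0r.
by move=> /esym /eqP; rewrite addrC addr_eq0 => /eqP.
Qed.

Lemma rsm_pairP : bilinear_pairing rsm_pair.
Proof.
split; [exact: rsm_pairDl|exact: rsm_pairZl|exact: rsm_pairDr|].
move=> a f mu; have [a0|a0] := leP 0 a; first exact: rsm_pairZr_ge0.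
have -> : a *: mu = - (- a *: mu) by rewrite scaleNr opprK.
by rewrite rsm_pairNr rsm_pairZr_ge0 ?oppr_ge0 ?ltW// mulNr opprK.
Qed.

Lemma rsm_pair_le_norm f mu : `|rsm_pair f mu| <= sup_norm f * `|mu|.
Proof.
have le (m : {finite_measure set borel -> \bar R}) :
    `|\int[m]_x f x| <= sup_norm f * fine (m setT).
  apply: le_trans (le_normr_Rintegral _ _) _ => //.
    exact: cspace_integrable.
  rewrite -[X in _ <= X]Rintegral_cst//; apply: le_Rintegral => //.
  - by have := integrable_norm (cspace_integrable m f); apply.
  - apply: measurable_bounded_integrable => //.
      by rewrite ltey_eq fin_num_measure.
    exact: bounded_cst.
  - by move=> x _; exact: le_sup_norm.
rewrite rsm_normE /rsm_pair /rsm_integral mulrDr.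
apply: le_trans (ler_normB _ _) _; apply: lerD; first exact: le.
have <- : fine (rsm_neg mu setT) = rpos (- mu) setT.
  by rewrite rpos_opp//; exact: measurableT.
exact: le.
Qed.

Hypothesis hK : hausdorff_space K.

Lemma urysohn_cspace (C U : set K) : closed C -> open U -> C `<=` U ->
  exists f, [/\ forall x, 0 <= f x <= 1, forall x, C x -> f x = 1 &
    forall x, ~ U x -> f x = 0].
Proof.
move=> cC oU CU; have nK := compact_normal hK cK.
have sep : uniform_separator (~` U) C.
  apply: (proj1 (@normal_separatorP R K) nK) => //; first exact: open_closedC.
  by rewrite -subset0 => x [nUx /CU].
pose h : K -> R^o := Urysohn (~` U) C.
have hP : h \in @cont_pred R K by rewrite inE; exact: Urysohn_continuous.
exists (CSpace cK hP); split=> x.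
- have /(_ (h x)) := @Urysohn_range K R (~` U) C.
  by move=> /(_ (ex_intro2 _ _ x I erefl)); rewrite /= in_itv.
- move=> Cx; have /(_ (h x)) := @Urysohn_sub1 K R _ _ sep.
  by apply; exists x.
- move=> Ux; have /(_ (h x)) := @Urysohn_sub0 K R _ _ sep.
  by apply; exists x.
Qed.

Lemma Rintegral_le_indic (m : {finite_measure set borel -> \bar R})
    (U : set K) f : measurable (U : set borel) -> (forall x, f x <= 1) ->
  (forall x, ~ U x -> f x = 0) -> \int[m]_x f x <= fine (m U).
Proof.
move=> mU f1 fU; have -> : \int[m]_x f x = \int[m]_(x in U) f x.
  rewrite [RHS]Rintegral_mkcond; apply: eq_Rintegral => x _.
  by rewrite patchE; case: ifPn => // /negP; rewrite inE => /fU.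
rewrite -[leRHS]mul1r -Rintegral_cst//; apply: le_Rintegral => //.
- apply: integrableS (cspace_integrable m f) => //; exact: measurableT.
- apply: measurable_bounded_integrable => //.
    by rewrite ltey_eq fin_num_measure.
  exact: bounded_cst.
Qed.

Lemma indic_le_Rintegral (m : {finite_measure set borel -> \bar R})
    (C : set K) f : measurable (C : set borel) -> (forall x, 0 <= f x) ->
  (forall x, C x -> f x = 1) -> fine (m C) <= \int[m]_x f x.
Proof.
move=> mC f0 fC; have mT : measurable [set: borel] by exact: measurableT.
have -> : fine (m C) = \int[m]_(x in C) f x.
  rewrite -[LHS]mul1r -Rintegral_cst//; apply: eq_Rintegral => x.
  by move=> /set_mem /fC ->.
have fi := cspace_integrable m f.
have fiC := integrableS mT mC (@subsetT _ C) fi.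
apply: fine_le; [exact: integrable_fin_num|exact: integrable_fin_num|].
apply: ge0_subset_integral => //; first exact: measurable_int fi.
by move=> x _; rewrite lee_fin.
Qed.

(* [mu^+ U] is the supremum of the integrals of the continuous functions
   between [0] and the indicator of [U]. *)
Lemma dual_sublinear_rpos (U : set K) : open U ->
  dual_sublinear rsm_pair (fun mu => rpos mu U).
Proof.
move=> oU; have mU : measurable (U : set borel) by exact: open_borel.
split=> [mu|mu t tU]; first exact: rpos_ge0.
have mUP := measurableI _ _ mU (measurable_hahn_pos mu).
(* One [e] is lost on the positive part and one on the negative part. *)
have [e e0 tE] : exists2 e : R, 0 < e & t = rpos mu U - 2 * e.
  by exists ((rpos mu U - t) / 2); [rewrite divr_gt0// subr_gt0|field].
(* The closed set [C] carries almost all of the positive part within [U] and none of the negative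
   part. *)
have [C [V [cC oV CUP UPV lt1]]] := regular_variation mu mUP e0.
have mC : measurable (C : set borel) by exact: closed_borel.
(* The open set [V'] around [C] has little variation beyond [C], so a function vanishing off it
   picks up little of the negative part. *)
have [C' [V' [cC' oV' CC' CV' lt2]]] := regular_variation mu mC e0.
have mV' : measurable (V' : set borel) by exact: open_borel.
have CUV : C `<=` U `&` V' by move=> x Cx; split; [case: (CUP _ Cx)|exact: CV'].
have oUV : open (U `&` V') by exact: openI.
have [f [f01 f1 f0]] := urysohn_cspace cC oUV CUV.
exists f; split.
  rewrite /rsm_pair /rsm_integral -/(rsm_pos mu) -/(rsm_neg mu).
  have h1 : rpos mu C <= \int[rsm_pos mu]_x f x.
    by apply: indic_le_Rintegral => // x; case/andP: (f01 x).
  have h2 : \int[rsm_neg mu]_x f x <= rpos (- mu) (U `&` V').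
    have <- : fine (rsm_neg mu (U `&` V')) = rpos (- mu) (U `&` V').
      by rewrite rpos_opp//; exact: open_borel.
    apply: Rintegral_le_indic => // [|x]; first exact: open_borel.
    by case/andP: (f01 x).
  have mVC : measurable (V `\` C : set borel).
    by apply: measurableD => //; exact: open_borel.
  have mVC' : measurable (V' `\` C' : set borel).
    by apply: measurableD => //; exact: closed_borel.
  move: lt1 lt2; rewrite !variation_rpos// !lte_fin => lt1 lt2.
  have g1 : rpos mu U <= rpos mu C + rpos mu (V `\` C).
    rewrite rpos_hahn//; apply: le_trans (rposU2 mu mC mVC).
    apply: rpos_ge => //; first exact: measurableU.
    move=> x UPx; have [Cx|Cx] := pselect (C x); first by left.
    by right; split=> //; exact: UPV.
  have g2 : rpos (- mu) (U `&` V') <= rpos (- mu) C + rpos (- mu) (V' `\` C').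
    apply: le_trans (rposU2 (- mu) mC mVC'); apply: rpos_le.
    - exact: open_borel.
    - exact: measurableU.
    - move=> x [Ux V'x]; have [Cx|Cx] := pselect (C x); [by left|right].
      by split=> // /CC'.
  have g3 : rpos (- mu) C = 0.
    apply: EFin_inj; rewrite -rpos_opp// rsm_neg_hahn//.
    have [_ _ _ PN0] := hahn_posneg (rsm_charge mu).
    rewrite (_ : C `&` _ = set0); last first.
      rewrite -subset0 => x [Cx Nx]; rewrite -PN0; split=> //.
      by case: (CUP _ Cx).
    by have := charge0 (rsm_charge mu) => -[->]; rewrite oppr0.
  have p1 := rpos_ge0 (- mu) (V `\` C); have p2 := rpos_ge0 mu (V' `\` C').
  suff concl (a b c d p q r s u v : R) : c <= u -> v <= d -> p + q < e ->
      r + s < e -> a <= c + p -> d <= 0 + s -> 0 <= q -> 0 <= r ->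
      a - 2 * e < u - v.
    by rewrite g3 in g2; rewrite tE; exact: concl h1 h2 lt1 lt2 g1 g2 p1 p2.
  by move=> *; lra.
move=> nu.
have [f1' f0'] : (forall x, f x <= 1) /\ (forall x, ~ U x -> f x = 0).
  split=> x; first by case/andP: (f01 x).
  by move=> Ux; apply: f0 => -[].
apply: le_trans (Rintegral_le_indic (rsm_pos nu) mU f1' f0').
rewrite gerBl; apply: Rintegral_ge0 => x _.
by case/andP: (f01 x).
Qed.

End rsm_duality.

(** * Dirac measures *)

Section dirac_rsm.
Context (R : realType) (K : ptopologicalType).
Hypothesis hK : hausdorff_space K.
Local Notation borel := (g_sigma_algebraType (@open K)).

(** The value 0 off the Borel sets is the convention of [rsm_pred]. *)
Definition dirac_fun (x : K) : set K -> R^o := fun A =>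
  if `[< measurable (A : set borel) >] then (x \in A)%:R else 0.

Let nu (x : K) : {charge set borel -> \bar R} :=
  charge_of_finite_measure (\d_(x : borel)).

Lemma dirac_fun_rsm x : dirac_fun x \in @rsm_pred R K.
Proof.
rewrite inE; exists (nu x).
  have cx : closed [set x].
    by apply: accessible_closed_set1; exact: hausdorff_accessible.
  have tv (V C : set K) : open V -> closed C -> ~ (V `\` C) x ->
      (Defs.total_variation (nu x) (V `\` C) <= 0)%E.
    move=> oV cC nVC.
    rewrite (@le_trans _ _ (\d_(x : borel) (V `\` C)))//; last first.
      by rewrite diracE memNset.
    apply: (@Defs.total_variation_le _ _ _ _ \d_(x : borel)).
    - by move=> A mA; rewrite gee0_abs// measure_ge0.
    - by move=> A B mA mB AB0; rewrite measureU.
    - by apply: measurableD; [exact: open_borel|exact: closed_borel].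
  move=> A mA e e0; have [Ax|Ax] := pselect (A x).
    exists [set x], setT; split=> //; first exact: openT.
      by move=> _ ->.
    apply: le_lt_trans (tv _ _ openT cx _) _; last by rewrite lte_fin.
    by move=> [_]; apply.
  exists set0, (~` [set x]); split=> //.
  - exact: closed0.
  - exact: closed_openC.
  - by move=> y Ay yx; apply: Ax; rewrite -yx.
  - apply: le_lt_trans (tv _ _ (closed_openC cx) closed0 _) _.
      by move=> [+ _]; apply.
    by rewrite lte_fin.
split=> A mA; rewrite /dirac_fun.
  by rewrite asboolT// [RHS]diracE.
by rewrite asboolF.
Qed.

Definition dirac_rsm x : rsm R K := RSM (dirac_fun_rsm x).

Lemma dirac_rsmE x (A : set borel) : measurable A ->
  dirac_rsm x A = (x \in A)%:R.
Proof. by move=> mA; rewrite /= /dirac_fun asboolT. Qed.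

Lemma dirac_rsm_norm x : (`|dirac_rsm x| : R) <= 1.
Proof.
have mT : measurable [set: borel] by exact: measurableT.
rewrite rsm_normE !rpos_hahn// rsmN !dirac_rsmE; last 2 first.
- by apply: measurableI => //; exact: measurable_hahn_pos.
- by apply: measurableI => //; exact: measurable_hahn_pos.
by case: (_ \in _); case: (_ \in _) => /=; lra.
Qed.

Lemma dirac_rsm_pair (cK : compact [set: K]) (f : cspace R cK) x :
  rsm_pair f (dirac_rsm x) = f x.
Proof.
rewrite /rsm_pair (rsm_integralE (m1 := \d_(x : borel)) (m2 := mzero)).
  rewrite /Rintegral integral_dirac//; last first.
    by apply/measurable_EFinP; exact: cspace_measurable.
  by rewrite integral_measure_zero diracT mul1e/= subr0.
move=> A mA; rewrite dirac_rsmE// -[RHS]/(\d_(x : borel) A - 0)%E.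
by rewrite sube0 diracE.
Qed.

End dirac_rsm.

(** * The norm on C(K) whose dual is a given norm on measures *)

Section predual_norm.
Context (R : realType) (K : ptopologicalType) (cK : compact [set: K]).
Hypothesis hK : hausdorff_space K.
Implicit Types (mu nu : rsm R K) (f g : cspace R cK).
Context (N : rsm R K -> R) (c C : R).
Hypotheses (dN : dual_sublinear (@rsm_pair R K cK) N) (c0 : 0 < c) (C0 : 0 < C).
Hypothesis NN : forall mu, N (- mu) = N mu.
Hypothesis cN : forall mu, c * `|mu| <= N mu.
Hypothesis NC : forall mu, N mu <= C * `|mu|.

Let pP := rsm_pairP R cK.

Let N_ge0 mu : 0 <= N mu. Proof. by case: dN. Qed.

Lemma dual_norm_scale a mu : N (a *: mu) = `|a| * N mu.
Proof.
have [a0|a0] := leP 0 a; first by rewrite (dual_sublinearZ pP)// ger0_norm.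
by rewrite -NN -scaleNr (dual_sublinearZ pP) ?ltr0_norm// oppr_ge0 ltW.
Qed.

Lemma equivalent_dual_norm : equivalent_norm N.
Proof.
split; last by exists c, C; split=> // mu; rewrite cN NC.
split; [by move=> *; exact: (dual_sublinearD_le pP)|exact: dual_norm_scale|].
move=> mu N0; apply/eqP; rewrite -normr_le0; have := cN mu.
by rewrite N0 pmulr_rle0.
Qed.

Definition predual_norm f : R :=
  sup [set `|rsm_pair f nu| | nu in [set nu | N nu <= 1]].

Let unit_ball_le nu : N nu <= 1 -> `|nu| <= c^-1.
Proof.
by move=> nu1; rewrite -(ler_pM2l c0) divff ?gt_eqF// (le_trans (cN nu)).
Qed.

Let pair_set_sup f :
  has_sup [set `|rsm_pair f nu| | nu in [set nu | N nu <= 1]].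
Proof.
split.
  exists `|rsm_pair f 0|, 0 => //=.
  by rewrite (dual_sublinear0 pP dN).
exists (sup_norm f / c) => _ [nu /= nu1 <-].
apply: le_trans (rsm_pair_le_norm f nu) _.
by rewrite ler_wpM2l ?sup_norm_ge0// unit_ball_le.
Qed.

Lemma predual_norm_ge f nu : N nu <= 1 -> `|rsm_pair f nu| <= predual_norm f.
Proof. by move=> nu1; apply: sup_upper_bound => //; exists nu. Qed.

Lemma predual_norm_le f M : (forall nu, N nu <= 1 -> `|rsm_pair f nu| <= M) ->
  predual_norm f <= M.
Proof.
move=> h; apply: ge_sup => [|_ [nu /= nu1 <-]]; last exact: h.
by case: (pair_set_sup f).
Qed.

Lemma predual_norm_ge0 f : 0 <= predual_norm f.
Proof.
apply: le_trans (normr_ge0 _) (@predual_norm_ge f 0 _).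
by rewrite (dual_sublinear0 pP dN).
Qed.

(** Dirac measures have norm at most 1, hence [N] at most [C] on them, and their pairings with [f]
    are its values. *)
Lemma sup_norm_le_predual f : `|f| <= C * predual_norm f.
Proof.
apply: sup_norm_le => [|x]; first by rewrite mulr_ge0 ?predual_norm_ge0 ?ltW.
have h : N (C^-1 *: dirac_rsm R hK x) <= 1.
  rewrite dual_norm_scale gtr0_norm ?invr_gt0// -(ler_pM2l C0) mulVKf ?gt_eqF//.
  apply: le_trans (NC _) _; by rewrite ler_pM2l// dirac_rsm_norm.
have := predual_norm_ge f h; case: pP => _ _ _ ->.
rewrite dirac_rsm_pair normrM gtr0_norm ?invr_gt0// mulrC ler_pdivrMr//.
by rewrite mulrC.
Qed.

Lemma equivalent_predual_norm : equivalent_norm predual_norm.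
Proof.
have pZ_le a f : predual_norm (a *: f) <= `|a| * predual_norm f.
  apply: predual_norm_le => nu nu1; case: pP => _ -> _ _.
  by rewrite normrM ler_wpM2l// predual_norm_ge.
split; [split|].
- move=> f g; apply: predual_norm_le => nu nu1; case: pP => -> _ _ _.
  by apply: le_trans (ler_normD _ _) _; rewrite lerD ?predual_norm_ge.
- move=> a f; apply/eqP; rewrite eq_le pZ_le /=.
  have [->|a0] := eqVneq a 0.
    by rewrite normr0 mul0r predual_norm_ge0.
  rewrite mulrC -ler_pdivlMr ?normr_gt0// mulrC -normfV.
  by rewrite -[f in predual_norm f <= _](scalerK a0) pZ_le.
- move=> f f0; apply/eqP; rewrite -normr_le0.
  by apply: le_trans (sup_norm_le_predual f) _; rewrite f0 mulr0.
exists C^-1, c^-1; split; rewrite ?invr_gt0// => f; apply/andP; split.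
  by rewrite mulrC ler_pdivrMr// mulrC sup_norm_le_predual.
apply: predual_norm_le => nu nu1.
apply: le_trans (rsm_pair_le_norm f nu) _; rewrite mulrC.
by apply: ler_wpM2r; [exact: sup_norm_ge0|exact: unit_ball_le].
Qed.

(** One inequality is the definition of [predual_norm], after scaling [mu]. For the other, the
    functionals below [N] that [dN] provides come close to [N mu], and they have predual norm at
    most 1 because [N] is even. *)
Lemma is_dual_norm_predual : is_dual_norm cK N.
Proof.
exists predual_norm; first exact: equivalent_predual_norm.
move=> mu.
have le f : predual_norm f <= 1 -> `|rsm_pair f mu| <= N mu.
  move=> f1; have [N0|N0] := eqVneq (N mu) 0.
    have [[_ _ /(_ _ N0) ->] _] := equivalent_dual_norm.
    case: pP => _ _ _ pZ; rewrite -(scale0r (0 : rsm R K)) pZ mul0r normr0.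
    exact: N_ge0.
  have Np : 0 < N mu by rewrite lt_neqAle eq_sym N0 N_ge0.
  have h : N ((N mu)^-1 *: mu) <= 1.
    by rewrite dual_norm_scale gtr0_norm ?invr_gt0// mulVf.
  have := le_trans (predual_norm_ge f h) f1.
  case: pP => _ _ _ ->; rewrite normrM gtr0_norm ?invr_gt0// mulrC.
  by rewrite ler_pdivrMr// mul1r.
apply/eqP; rewrite eq_le; apply/andP; split; last first.
  apply: ge_sup => [|_ [f /= f1 <-]]; last exact: le.
  exists `|rsm_integral mu (0 : cspace R cK)|, 0 => //=.
  have [[_ pZ _] _] := equivalent_predual_norm.
  by rewrite -(scale0r (0 : cspace R cK)) pZ normr0 mul0r.
rewrite leNgt; apply/negP => /(proj2 dN)[f [tf fN]].
move: tf; apply/negP; rewrite -leNgt; apply: le_trans (ler_norm _) _.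
apply: ub_le_sup; first by exists (N mu) => _ [g /= g1 <-]; exact: le.
exists f => //=; apply: predual_norm_le => nu nu1; apply: le_trans nu1.
rewrite ler_norml fN andbT lerNl -(NN nu).
by case: pP => _ _ _ pZ; rewrite -[X in X <= _]mulN1r -pZ scaleN1r.
Qed.

End predual_norm.

Lemma nonexpansive_continuous (R : realType) (V : normedModType R)
  (f : V -> R^o) : (forall x y, `|f x - f y| <= `|x - y|) -> continuous f.
Proof.
move=> fle x; apply/cvgrPdist_lt => e e0; near=> y.
apply: le_lt_trans (fle x y) _; near: y.
exact: (@cvgr_dist_lt _ _ _ _ _ id x cvg_id e e0).
Unshelve. all: by end_near. Qed.

(** The midpoint of [x] and [y] is recovered from its own midpoint with [x], at weight 2/3, and from
    [y], at weight 1/3; this serves to bound a norm at the inner midpoint from below. *)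
Lemma midpoint_back (R : numFieldType) (V : lmodType R) (x y : V) :
  2^-1 *: (x + y) =
  (2 / 3) *: (2^-1 *: (x + 2^-1 *: (x + y))) + 3^-1 *: y.
Proof.
transitivity ((2 / 3 * 2^-1 + 2 / 3 * 2^-1 * 2^-1) *: x +
    (2 / 3 * 2^-1 * 2^-1 + 3^-1) *: y); last first.
  by rewrite !scalerDl !scalerDr !scalerA !addrA.
rewrite scalerDr; congr (_ *: _ + _ *: _).
  by field.
by field.
Qed.

(** * Norms on the dual of C(K) for a Gruenhage compact K *)

(** The condition of pointwise uniform rotundity for one functional; the continuous linear
    functionals that satisfy it form a subspace, which serves as [F]. *)
Definition rotund_for (R : realType) (V : normedModType R) (N : V -> R)
    (f : V -> R^o) : Prop :=
  forall x y : nat -> V, (forall n, N (x n) = 1) -> (forall n, N (y n) = 1) ->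
  N (x n + y n) @[n --> \oo] --> (2 : R) ->
  f (x n - y n) @[n --> \oo] --> (0 : R^o).

Lemma dual_subspace_rotund_for (R : realType) (V : normedModType R)
    (N : V -> R) :
  dual_subspace [set f | [/\ linear f, continuous f & rotund_for N f]].
Proof.
split=> [f [] //||a f g [lf cf rf] [lg cg rg]].
  split=> [a u v||x y _ _ _]; [|exact: cst_continuous|exact: cvg_cst].
  by rewrite -[RHS]/(a * 0 + 0 : R) mulr0 addr0.
split=> [b u v|x|x y x1 y1 xy].
- rewrite -![(a *: f + g) _]/(a *: f _ + g _) lf lg !scalerDr !scalerA.
  by rewrite addrACA (mulrC a).
- exact: (cvgD (cvgZl_tmp (k := a) (cf x)) (cg x)).
- have := cvgD (cvgZl_tmp (k := a) (rf _ _ x1 y1 xy)) (rg _ _ x1 y1 xy).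
  by rewrite scaler0 addr0; exact.
Qed.

Section gruenhage_norms.
Context (R : realType) (K : ptopologicalType) (cK : compact [set: K]).
Hypothesis hK : hausdorff_space K.
Local Notation borel := (g_sigma_algebraType (@open K)).
Implicit Types mu nu : rsm R K.

(** The terms are the masses of pairwise disjoint cells, so they sum to the mass of a union. *)
Lemma rpos_family_sum mu (G : set_family K) (s : seq (set K)) :
  almost_disjoint G -> uniq s -> {in s, forall V, G.2 V} ->
  \sum_(V <- s) (rpos mu V - rpos mu G.1) <= rpos mu setT.
Proof.
move=> [oR oV RV dV] us sG.
pose W (s : seq (set K)) : set K :=
  [set x | exists2 V, V \in s & (V `\` G.1) x].
have mR : measurable (G.1 : set borel) by exact: open_borel.
have WE V t : W (V :: t) = (V `\` G.1) `|` W t.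
  apply/seteqP; split=> x.
    by move=> [V']; rewrite inE => /predU1P[->|V't]; [left|right; exists V'].
  move=> [Vx|[V' V't V'x]]; first by exists V => //; rewrite mem_head.
  by exists V' => //; rewrite inE V't orbT.
have [mW le] : measurable (W s : set borel) /\
    \sum_(V <- s) (rpos mu V - rpos mu G.1) <= rpos mu (W s).
  elim: s us sG => [|V s ih] /= us sG.
    rewrite big_nil rpos_ge0 (_ : W _ = set0)//.
    by rewrite -subset0 => x [].
  move: us => /andP[Vs us].
  have GV : G.2 V by apply: sG; rewrite mem_head.
  have sG' : {in s, forall V, G.2 V}.
    by move=> V' V's; apply: sG; rewrite inE V's orbT.
  have [mW le] := ih us sG'.
  have mV : measurable (V : set borel) by apply: open_borel; exact: oV.
  have mVR : measurable (V `\` G.1 : set borel) by exact: measurableD.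
  rewrite WE big_cons; split; first exact: measurableU.
  rewrite rposU// ?rpos_setD//; [exact: lerD|exact: RV|].
  rewrite -subset0 => x [[Vx nRx] [V' V's [V'x _]]]; apply: nRx.
  apply: (dV V V') => //; first exact: sG'.
  by move=> VV'; rewrite VV' V's in Vs.
by apply: le_trans le _; apply: rpos_le => //; exact: measurableT.
Qed.

(* [mu^+ V] or [|mu| V] for open [V], according to [b]; the interior makes this
   a dual sublinear functional for all sets. *)
Definition set_weight (b : bool) (V : set K) mu : R :=
  rpos mu (interior V) + (if b then rpos (- mu) (interior V) else 0).

Let m_int (V : set K) : measurable (interior V : set borel).
Proof. by apply: open_borel; exact: open_interior. Qed.

Lemma set_weight_open b V mu : open V ->
  set_weight b V mu = rpos mu V + (if b then rpos (- mu) V else 0).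
Proof. by rewrite /set_weight => /interior_id ->. Qed.

Lemma dual_sublinear_set_weight b V :
  dual_sublinear (@rsm_pair R K cK) (set_weight b V).
Proof.
have dV := dual_sublinear_rpos R cK hK (@open_interior _ V).
apply: (dual_sublinearD (rsm_pairP R cK) dV); case: b.
  exact: (dual_sublinear_opp (rsm_pairP R cK) dV).
exact: (dual_sublinear_cst0 (rsm_pairP R cK)).
Qed.

Lemma set_weight_le b V mu : set_weight b V mu <= `|mu|.
Proof.
rewrite rsm_normE /set_weight; apply: lerD.
  by apply: rpos_le => //; exact: measurableT.
by case: b; [apply: rpos_le => //; exact: measurableT|exact: rpos_ge0].
Qed.

Context (B : countType) (F : B -> set_family K).
Hypothesis adF : forall b, almost_disjoint (F b).
Hypothesis sepF : forall x y, x <> y ->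
  exists b C, cells (F b) C /\ (C x /\ ~ C y \/ ~ C x /\ C y).

Let root (j : seq B) := (meet_families F j).1.
Let members (j : seq B) := (meet_families F j).2.
Let adM j : almost_disjoint (meet_families F j).
Proof. exact: almost_disjoint_families. Qed.

Let open_root j : open (root j). Proof. by case: (adM j). Qed.
Let open_member j V : members j V -> open V.
Proof. by case: (adM j) => _ + _ _; apply. Qed.

Lemma set_weight_root_le b j mu V : members j V ->
  set_weight b (root j) mu <= set_weight b V mu.
Proof.
move=> jV; have RV : root j `<=` V by case: (adM j) => _ _ + _; apply.
have le nu : rpos nu (interior (root j)) <= rpos nu (interior V).
  by apply: rpos_le => //; exact: interiorS.
by apply: lerD => //; case: b.
Qed.

Lemma set_weight_sum_le b j mu (s : seq (set K)) : uniq s ->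
  {in s, forall V, members j V} ->
  \sum_(V <- s) (set_weight b V mu - set_weight b (root j) mu) <= `|mu|.
Proof.
move=> us sj; rewrite rsm_normE.
rewrite (eq_big_seq (fun V => (rpos mu V - rpos mu (root j)) +
  (if b then rpos (- mu) V - rpos (- mu) (root j) else 0))); last first.
  move=> V /sj /open_member oV; rewrite !set_weight_open//.
  by case: b; [rewrite opprD addrACA|rewrite !addr0].
rewrite big_split/=; apply: lerD; first exact: rpos_family_sum (adM j) us sj.
case: b; first exact: rpos_family_sum (adM j) us sj.
by rewrite big1// rpos_ge0.
Qed.

Definition gruenhage_norm b : rsm R K -> R :=
  family_norm (set_weight b) root members.

Let normN mu : `|- mu| = `|mu|. Proof. exact: normrN. Qed.

Let g_le b (j : seq B) mu V : V = root j \/ members j V ->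
  set_weight b V mu <= `|mu|.
Proof. by move=> _; exact: set_weight_le. Qed.

Lemma dual_sublinear_gruenhage b :
  dual_sublinear (@rsm_pair R K cK) (gruenhage_norm b).
Proof.
exact: (dual_sublinear_family_norm (rsm_pairP R cK) normN
  (dual_sublinear_set_weight b) (@g_le b)).
Qed.

Lemma gruenhage_normN b mu : gruenhage_norm b (- mu) = gruenhage_norm b mu.
Proof. exact: family_normN. Qed.

Lemma gruenhage_norm_le b mu : gruenhage_norm b mu <= 1 * `|mu|.
Proof.
rewrite mul1r; exact: (family_norm_le normN (dual_sublinear_set_weight b)
  (@g_le b) (@normr_ge0 _ _)).
Qed.

Lemma gruenhage_norm_ge b : exists2 c : R, 0 < c &
  forall mu, c * `|mu| <= gruenhage_norm b mu.
Proof.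
(* The empty list has the whole space as its member; there the weights of [mu] and [- mu] add up to
   the norm or to twice the norm. *)
apply: (family_norm_ge normN (dual_sublinear_set_weight b) (@g_le b)
  (@normr_ge0 _ _) (j := [::]) (i := setT)); first by right.
move=> mu; rewrite !set_weight_open ?rsm_normE ?opprK; [|exact: openT..].
have := rpos_ge0 mu setT; have := rpos_ge0 (- mu) setT.
by case: b => ? ?; lra.
Qed.

Lemma gruenhage_norm_dual b :
  equivalent_norm (gruenhage_norm b) /\ is_dual_norm cK (gruenhage_norm b).
Proof.
have [c c0 cN] := gruenhage_norm_ge b; split.
  exact: (equivalent_dual_norm (dual_sublinear_gruenhage b) c0 ltr01
    (gruenhage_normN b) cN (gruenhage_norm_le b)).
exact: (is_dual_norm_predual hK (dual_sublinear_gruenhage b) c0 ltr01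
  (gruenhage_normN b) cN (gruenhage_norm_le b)).
Qed.

Lemma gruenhage_norm_lattice : lattice_norm (gruenhage_norm true).
Proof.
move=> mu nu le.
have lew V : rpos mu (interior V) + rpos (- mu) (interior V) <=
    rpos nu (interior V) + rpos (- nu) (interior V).
  by rewrite -lee_fin -!variation_rpos// le.
apply: (family_norm_mono normN (dual_sublinear_set_weight true) (@g_le true)).
move=> j V _.
by rewrite /set_weight !opprK; split; [|rewrite addrC [leRHS]addrC]; exact: lew.
Qed.

Lemma gruenhage_norm_uniform b j V (C e : R) : V = root j \/ members j V ->
  0 < e -> exists2 d : R, 0 < d & forall mu nu, `|mu| <= C -> `|nu| <= C ->
    (gruenhage_norm b mu ^+ 2 + gruenhage_norm b nu ^+ 2) / 2 -
      gruenhage_norm b (2^-1 *: (mu + nu)) ^+ 2 < d ->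
    `|set_weight b V mu - set_weight b V nu| <= e /\
    `|set_weight b V (- mu) - set_weight b V (- nu)| <= e.
Proof.
exact: (family_norm_uniform (rsm_pairP R cK) normN
  (dual_sublinear_set_weight b) (@g_le b) (@set_weight_root_le b)
  (@set_weight_sum_le b)).
Qed.

(** The measure of a cell is the weight of its member minus that of the root, so equal weights give
    equal measures on all cells, and [cells_measure_unique] applies. *)
Lemma rpos_cells_eq mu nu b :
  (forall j V, V = root j \/ members j V ->
    set_weight b V mu = set_weight b V nu) ->
  forall A : set borel, measurable A ->
    rpos mu A + (if b then rpos (- mu) A else 0) =
    rpos nu A + (if b then rpos (- nu) A else 0).
Proof.
move=> E.
pose n la : {measure set borel -> \bar R} :=
  if b then rsm_pos (- la) : {measure set borel -> \bar R} else mzero.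
pose m la := measure_add (rsm_pos la) (n la).
have mE la A : measurable A ->
    m la A = (rpos la A + (if b then rpos (- la) A else 0))%:E.
  move=> mA; rewrite /m measure_addE EFinD -rposE//; congr (_ + _)%E.
  by rewrite /n; case b => //; rewrite -rposE.
have rm la : regular_measure (m la).
  apply: regular_measureD; first exact: regular_rsm_pos.
  rewrite /n; case b; first exact: regular_rsm_pos.
  move=> A mA e e0; exists set0, setT; split=> //.
  - exact: closed0.
  - exact: openT.
suff mm A : measurable A -> m mu A = m nu A.
  by move=> A mA; apply: EFin_inj; rewrite -!mE// mm.
apply: (cells_measure_unique cK adF sepF _ (rm mu) (rm nu)).
  by rewrite -[X in (X < _)%E]/(m mu setT) mE ?ltry//; exact: measurableT.
move=> _ [j _ [V jV <-]].
have mV : measurable (V : set borel).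
  by apply: open_borel; exact: open_member jV.
have mR : measurable (root j : set borel) by exact: open_borel.
have RV : root j `<=` V by case: (adM j) => _ _ + _; apply.
rewrite -[LHS]/(m mu _) -[RHS]/(m nu _) !mE; try exact: measurableD.
have EV := E j V (or_intror jV); have ER := E j (root j) (or_introl erefl).
rewrite !set_weight_open// in EV ER; try exact: open_member jV.
rewrite !rpos_setD//; congr EFin; case: b EV ER {E m n mE rm} => /= EV ER; lra.
Qed.

Let half_double (a : R) : (a + a) / 2 = a.
Proof. by field. Qed.

Let half_defect0 (a : R) : (a ^+ 2 + a ^+ 2) / 2 - a ^+ 2 = 0.
Proof. by field. Qed.

(** Under these equalities the defect is 0, hence below every [d] of [gruenhage_norm_uniform]. *)
Lemma gruenhage_norm_eq b mu nu :
  gruenhage_norm b mu = gruenhage_norm b nu ->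
  gruenhage_norm b (2^-1 *: (mu + nu)) = gruenhage_norm b mu ->
  forall j V, V = root j \/ members j V ->
    set_weight b V mu = set_weight b V nu.
Proof.
move=> E1 E2 j V jV; apply/eqP; rewrite -subr_eq0 -normr_le0.
apply/ler_addgt0Pl => e e0; rewrite addr0.
have [d d0 dP] := gruenhage_norm_uniform b (`|mu| + `|nu|) jV e0.
have def : (gruenhage_norm b mu ^+ 2 + gruenhage_norm b nu ^+ 2) / 2 -
    gruenhage_norm b (2^-1 *: (mu + nu)) ^+ 2 < d.
  by rewrite E2 -E1 half_defect0.
have mC : `|mu| <= `|mu| + `|nu| := ler_wpDr (normr_ge0 nu) (lexx _).
have nC : `|nu| <= `|mu| + `|nu| := ler_wpDl (normr_ge0 mu) (lexx _).
by have [] := dP mu nu mC nC def.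
Qed.

(** Since [variation_midpoint] also asks for the variation of the midpoint [la], the hypothesis is
    applied twice: to [mu] and [nu], then to [mu] and [la]. *)
Lemma strictly_convex_variation (N : rsm R K -> R) :
  dual_sublinear (@rsm_pair R K cK) N ->
  (forall mu nu, N mu = N nu -> N (2^-1 *: (mu + nu)) = N mu ->
    forall A : set borel, measurable A ->
      Defs.variation mu A = Defs.variation nu A) ->
  strictly_convex N.
Proof.
move=> dN var_eq mu nu E1 E2; have pP := rsm_pairP R cK.
have E3 : N (2^-1 *: (mu + nu)) = N mu by rewrite (dual_sublinearZ pP)// E1 -E2.
apply: variation_midpoint; first by apply: var_eq.
apply: var_eq => //; move: E3; set la := 2^-1 *: (mu + nu) => E3.
apply/eqP; rewrite eq_le; apply/andP; split.
  have := dual_sublinear_half pP mu la dN; rewrite E3.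
  by rewrite half_double.
(* By sublinearity [N la] is at most two thirds of [N w] plus a third of [N nu], so [N w] cannot be
   smaller than [N mu]. *)
have laE : la = (2 / 3) *: (2^-1 *: (mu + la)) + 3^-1 *: nu.
  exact: midpoint_back.
move: laE; move: (2^-1 *: (mu + la)) => w laE.
have := dual_sublinearD_le pP ((2 / 3) *: w) (3^-1 *: nu) dN.
rewrite -laE E3 !(dual_sublinearZ pP)// -E1.
by move: (N w) (N mu) => u v; lra.
Qed.

Lemma gruenhage_norm_strictly_convex : strictly_convex (gruenhage_norm true).
Proof.
apply: strictly_convex_variation => [|mu nu E1 E2 A mA].
  exact: dual_sublinear_gruenhage.
rewrite (variation_rpos mu mA) (variation_rpos nu mA).
exact: (congr1 EFin (rpos_cells_eq (gruenhage_norm_eq E1 E2) mA)).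
Qed.

Lemma eval_continuous (A : set borel) : measurable A ->
  continuous (fun mu => mu A : R^o).
Proof.
move=> mA; apply: (@nonexpansive_continuous R (rsm R K)) => mu nu.
exact: (rsm_le_norm (mu - nu) mA).
Qed.

(** On the unit sphere of [N] the norms are at most [c^-1] and the defect is
    [1 - (N (x n + y n) / 2) ^+ 2], which tends to 0; hence the uniform estimate holds eventually
    for every [e]. *)
Lemma rotund_for_eval (N w : rsm R K -> R) (c : R) (A : set borel) :
  dual_sublinear (@rsm_pair R K cK) N ->
  0 < c -> (forall mu, c * `|mu| <= N mu) ->
  (forall mu, mu A = w mu - w (- mu)) ->
  (forall e : R, 0 < e -> exists2 d : R, 0 < d & forall mu nu,
    `|mu| <= c^-1 -> `|nu| <= c^-1 ->
    (N mu ^+ 2 + N nu ^+ 2) / 2 - N (2^-1 *: (mu + nu)) ^+ 2 < d ->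
    `|w mu - w nu| <= e /\ `|w (- mu) - w (- nu)| <= e) ->
  rotund_for (V := rsm R K) N (fun mu => mu A).
Proof.
move=> dN c0 cN wA unif x y x1 y1 xy; have pP := rsm_pairP R cK.
have bound mu : N mu = 1 -> `|mu| <= c^-1.
  by move=> mu1; rewrite -(ler_pM2l c0) divff ?gt_eqF// -mu1 cN.
apply/cvgrPdist_le => e e0.
have e20 : 0 < e / 2 by rewrite divr_gt0.
have [d d0 dP] := unif _ e20.
have : 1 - (2^-1 * N (x n + y n)) ^+ 2 @[n --> \oo] --> 1 - (2^-1 * 2 : R) ^+ 2.
  apply: cvgB; first exact: cvg_cst.
  rewrite [X in _ --> X]expr2; under eq_fun do rewrite expr2.
  by apply: cvgM; apply: cvgMr.
rewrite mulVf// expr1n subrr => /cvgrPdist_lt /(_ d d0) lim0.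
near=> n.
have def : (N (x n) ^+ 2 + N (y n) ^+ 2) / 2 - N (2^-1 *: (x n + y n)) ^+ 2 < d.
  rewrite (dual_sublinearZ pP)// x1 y1 expr1n.
  rewrite (_ : (1 + 1) / 2 = 1 :> R); last by field.
  apply: le_lt_trans (ler_norm _) _; rewrite -normrN -sub0r.
  by near: n.
have [] := dP (x n) (y n) (bound _ (x1 n)) (bound _ (y1 n)) def.
rewrite sub0r normrN -[X in `|X| <= e]/(x n A - y n A) !wA.
rewrite !ler_norml => /andP[a1 a2] /andP[a3 a4].
by apply/andP; split; lra.
Unshelve. all: by end_near. Qed.

Lemma eval_rotund j V : V = root j \/ members j V ->
  rotund_for (V := rsm R K) (gruenhage_norm false) (fun mu => mu V).
Proof.
move=> jV; have oV : open V by case: jV => [->|/open_member].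
have mV : measurable (V : set borel) by exact: open_borel.
have [c c0 cN] := gruenhage_norm_ge false.
apply: (rotund_for_eval (dual_sublinear_gruenhage false) c0 cN
  (w := set_weight false V)) => [mu|e e0].
  by rewrite !set_weight_open// !addr0 rsm_rpos.
exact: (gruenhage_norm_uniform false c^-1 jV e0).
Qed.

(** The difference [d] vanishes on roots and members, so [d] and [- d] have the same positive part
    there, hence on all Borel sets. *)
Lemma rsm_eq_families mu nu :
  (forall j V, V = root j \/ members j V -> mu V = nu V) -> mu = nu.
Proof.
move=> E; apply/eqP; rewrite -subr_eq0; apply/eqP.
set d := mu - nu.
have d0 j V : V = root j \/ members j V ->
    set_weight false V d = set_weight false V (- d).
  move=> jV; have oV : open V by case: jV => [->|/open_member].
  have dV : d V = 0 by rewrite -[LHS]/(mu V - nu V) (E j V jV) subrr.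
  rewrite !set_weight_open// !addr0; apply/eqP; rewrite -subr_eq0.
  by rewrite -(rsm_rpos d (open_borel oV)) dV.
apply: rsm_ext => A mA; have := rpos_cells_eq d0 mA; rewrite !addr0 => h.
by rewrite rsm_rpos// h subrr.
Qed.

Lemma gruenhage_norm_pointwise_uniformly_rotund :
  pointwise_uniformly_rotund (gruenhage_norm false).
Proof.
exists [set f | [/\ linear f, continuous f &
  rotund_for (V := rsm R K) (gruenhage_norm false) f]].
split.
- exact: dual_subspace_rotund_for.
- move=> x y xy; apply: contrapT => nf; apply: xy.
  apply: rsm_eq_families => j V jV; apply: contrapT => xVy; apply: nf.
  exists (fun mu => mu V) => //; split=> //; last exact: eval_rotund jV.
  apply: eval_continuous; apply: open_borel.
  by case: jV => [->|/open_member].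
- by move=> x y x1 y1 xy f [_ _]; apply.
Qed.

End gruenhage_norms.

Theorem theorem2p6 (R : realType) (K : ptopologicalType)
    (cK : compact [set: K]) (hK : hausdorff_space K) (gK : gruenhage K) :
  (exists N : rsm R K -> R,
     [/\ equivalent_norm N, strictly_convex N, is_dual_norm cK N &
         lattice_norm N]) /\
  (exists N : rsm R K -> R,
     [/\ equivalent_norm N, is_dual_norm cK N &
         pointwise_uniformly_rotund N]).
Proof.
have [U [oU sepU]] := gK.
have adF := almost_disjoint_gruenhage oU.
have sepF x y (xy : x <> y) := gruenhage_family_separates (sepU x y xy) xy.
split.
  (* With [true] the weights are values of the variation, which makes the norm a lattice norm. *)
  exists (gruenhage_norm (gruenhage_family U) true).
  have [eN dN] := gruenhage_norm_dual R cK hK (gruenhage_family U) true.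
  split; [exact: eN| |exact: dN|].
    exact: (gruenhage_norm_strictly_convex cK hK adF sepF).
  exact: gruenhage_norm_lattice.
(* With [false] the positive parts of [mu] and [- mu] are controlled separately, hence also their
   difference, the value of [mu]. *)
exists (gruenhage_norm (gruenhage_family U) false).
have [eN dN] := gruenhage_norm_dual R cK hK (gruenhage_family U) false.
split; [exact: eN|exact: dN|].
exact: (gruenhage_norm_pointwise_uniformly_rotund R cK hK adF sepF).
Qed.
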